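(* Let $\alpha\in\mathbb{J}$ and assume $P=\{P_1,\ldots,P_n\}\in\mathscr{P}_{\beta_1,\ldots,\beta_n,R}$. For $\beta\in\mathbb{J}$ let $\mathcal{R}_\beta:=\{\gamma'\in\mathbb{J}:\mathtt{r}(\gamma')\in[\mathtt{r}(\beta),\mathtt{r}(\beta)+1)\text{ and }\beta\stackrel{S(t)}{\leadsto}\gamma'\}$ and consider $$\mathcal{R}_{\beta_1,\ldots,\beta_n}:=\bigcap_{i=1}^n\mathcal{R}_{\beta_i}.$$ Then $\alpha\in\mathcal{R}_{\beta_1,\ldots,\beta_n}$. Moreover: (i) Assume $\gamma\in\mathcal{E}_\alpha$, $\gamma'\in\mathcal{R}_{\beta_1,\ldots,\beta_n}$ and $\gamma\stackrel{S(t)}{\dashrightarrow}\gamma'$. Then $\gamma\stackrel{S_P(t)}{\dashrightarrow}\gamma'$, that is, for any $T>0$ there exists $M=M(\gamma,\gamma',T)$ (nondecreasing in $T$) such that $$\|S_P(t)\|_{\mathcal{L}(X^\gamma,X^{\gamma'})}\le\frac{M}{t^{d(\gamma',\gamma)}},\quad 0<t\le T.\qquad( * )$$ (ii) Assume $\gamma\in\mathcal{E}_\alpha$, $\gamma'\in\mathcal{R}_{\beta_1,\ldots,\beta_n}$ and $\gamma\stackrel{S(t)}{\leadsto}\gamma'$. Then $\gamma\stackrel{S_P(t)}{\leadsto}\gamma'$, that is, $( * )$ holds and $(0,\infty)\ni t\mapsto S_P(t)u_0\in X^{\gamma'}$ is continuous for every $u_0\in X^\gamma$.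
   Context: Scale of spaces: $\mathbb{J}$ is a set of indices and $\{X^\gamma\}_{\gamma\in\mathbb{J}}$ a family of Banach spaces (norms $\|\cdot\|_\gamma$) that is topologically consistent: if a sequence in $X^\gamma\cap X^{\tilde\gamma}$ converges in both spaces, the limits coincide. A map $\mathtt{r}:\mathbb{J}\to\mathbb{R}$ (regularity index) is given and $d(\tilde\gamma,\gamma):=\mathtt{r}(\tilde\gamma)-\mathtt{r}(\gamma)$. $\{S(t)\}_{t\ge0}$ is a family of linear operators with $S(0)=I$ defined consistently on the spaces of the scale (if $u_0\in X^\gamma\cap X^{\tilde\gamma}$, the values of $S(t)u_0$ in the two spaces coincide). Smoothing: $\gamma\stackrel{S(t)}{\dashrightarrow}\tilde\gamma$ means that $d(\tilde\gamma,\gamma)\ge0$ and for any $T>0$ there is a constant $M=M(\gamma,\tilde\gamma,T)$ (nondecreasing in $T$) with $\|S(t)\|_{\mathcal{L}(X^\gamma,X^{\tilde\gamma})}\le M t^{-d(\tilde\gamma,\gamma)}$ for $0<t\le T$. $\gamma\stackrel{S(t)}{\leadsto}\tilde\gamma$ means that in addition $(0,\infty)\ni t\mapsto S(t)u_0\in X^{\tilde\gamma}$ is continuous for each $u_0\in X^\gamma$. The same notations are used for the family $S_P$. Perturbations: for fixed $\alpha\in\mathbb{J}$, $R>0$ and $\beta\in\mathbb{J}$, $\mathscr{P}_{\beta,R}$ is the set of $P\in\mathcal{L}(X^\alpha,X^\beta)$ with $\|P\|_{\mathcal{L}(X^\alpha,X^\beta)}\le R$, where $\alpha,\beta$ satisfy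 $0\le d(\alpha,\beta)<1$ and $\beta\stackrel{S(t)}{\leadsto}\alpha$. $P=\{P_1,\ldots,P_n\}\in\mathscr{P}_{\beta_1,\ldots,\beta_n,R}$ means $P_i\in\mathscr{P}_{\beta_i,R}$ for each $i$. Perturbed family: $\mathcal{E}_\alpha:=\{\gamma\in\mathbb{J}:\mathtt{r}(\gamma)\in(\mathtt{r}(\alpha)-1,\mathtt{r}(\alpha)]\text{ and }\gamma\stackrel{S(t)}{\leadsto}\alpha\}$. $\mathcal{L}^\infty_{\alpha,\varepsilon}$ is the set of strongly measurable $\varphi:(0,\infty)\to X^\alpha$ with $\sup_{t\in(0,T]}t^\varepsilon\|\varphi(t)\|_\alpha<\infty$ for every $T>0$. For $\gamma\in\mathcal{E}_\alpha$ and $u_0\in X^\gamma$ there is a unique $u\in\mathcal{L}^\infty_{\alpha,d(\alpha,\gamma)}$ with $u(t)=S(t)u_0+\sum_{i=1}^n\int_0^tS(t-\tau)P_iu(\tau)\,d\tau$ for all $t>0$; $S_P(t)u_0:=u(t)$ for $t>0$ and $S_P(0)u_0:=u_0$. *)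

(* Defs.v *)
From HB Require Import structures.
From mathcomp Require Import all_boot all_order all_algebra.
From mathcomp Require Import all_classical all_reals all_analysis.
Set Implicit Arguments.
Unset Strict Implicit.
Unset Printing Implicit Defensive.
Import Order.TTheory GRing.Theory Num.Theory.
Import numFieldNormedType.Exports.
Local Open Scope classical_set_scope.
Local Open Scope ring_scope.

Section BochnerIntegral.
Context d (T : measurableType d) (R : realType) (E : normedModType R).
Variables (mu : {measure set T -> \bar R}) (D : set T).

Definition simple_function (s : T -> E) :=
  finite_set (range s) /\ forall y, measurable (s @^-1` [set y]).

Definition integrable_simple (s : T -> E) :=
  simple_function s /\
  forall y, y != 0 -> (mu (D `&` s @^-1` [set y]) < +oo)%E.

Definition simple_integral (s : T -> E) : E :=
  \sum_(y \in range s) fine (mu (D `&` s @^-1` [set y])) *: y.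

Definition strongly_measurable (f : T -> E) :=
  exists s : nat -> T -> E, (forall n, simple_function (s n)) /\
    {ae mu, forall x, D x -> s ^~ x @ \oo --> f x}.

(* [f] is Bochner integrable on [D] and its integral is [I]. *)
Definition is_bochner_integral (f : T -> E) (I : E) :=
  strongly_measurable f /\
  exists s : nat -> T -> E,
    [/\ forall n, integrable_simple (s n),
        (fun n => \int[mu]_(x in D) (`|f x - s n x|)%:E)%E @ \oo --> 0%E
      & (fun n => simple_integral (s n)) @ \oo --> I].

End BochnerIntegral.

Section BoundedOperators.
Context (R : realType) (E F : normedModType R).

Definition bounded_operator (A : E -> F) := linear A /\ continuous A.

Definition opnorm (A : E -> F) : R :=
  sup [set `|A x| | x in [set x : E | `|x| <= 1]].

End BoundedOperators.

(* The spaces are linearly embedded in a common vector space without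
   topology, in which intersections of spaces and equalities between elements
   of different spaces make sense. *)
Record banach_scale (R : realType) := BanachScale {
  scale_index : Type;
  space :> scale_index -> completeNormedModType R;
  ambient : lmodType R;
  incl : forall g, {linear space g -> ambient};
  incl_inj : forall g, injective (incl g);
  topologically_consistent : forall (g g' : scale_index)
    (x : nat -> space g) (y : nat -> space g') (a : space g) (b : space g'),
    (forall n, incl g (x n) = incl g' (y n)) ->
    x @ \oo --> a -> y @ \oo --> b -> incl g a = incl g' b;
  regularity : scale_index -> R
}.

Section Scale.
Context (R : realType) (X : banach_scale R).
Local Notation J := (scale_index X).
Local Notation mu := (@lebesgue_measure R).

Definition reg_diff (g' g : J) : R := regularity g' - regularity g.

(* [F g t u0] is the value at time [t] of the family on [u0] in [X g]; it is
   an element of the ambient space because the spaces containing it depend on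
   the smoothing properties of the family. *)
Definition op_family := forall g : J, R -> X g -> ambient X.

(* The default value 0 is not used: the smoothing relations below include
   membership in the target space. *)
Definition val_in (g : J) (v : ambient X) : X g :=
  xget 0 [set x | incl g x = v].

Definition op_between (F : op_family) (g g' : J) (t : R) : X g -> X g' :=
  fun u0 => val_in g' (F g t u0).

Definition bounded_between (F : op_family) (g g' : J) (t : R) :=
  (forall u0, range (incl g') (F g t u0)) /\
  bounded_operator (op_between F g' t : X g -> X g').

Definition smoothing (F : op_family) (g g' : J) :=
  0 <= reg_diff g' g /\
  exists M : R -> R,
    (forall T1 T2 : R, 0 < T1 -> T1 <= T2 -> M T1 <= M T2) /\
    forall T : R, 0 < T -> forall t : R, 0 < t <= T ->
      bounded_between F g g' t /\
      opnorm (op_between F g' t : X g -> X g') <=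
        M T * t `^ (- reg_diff g' g).

Definition smoothing_continuous (F : op_family) (g g' : J) :=
  smoothing F g g' /\
  forall u0 : X g,
    {within `]0, +oo[, continuous (fun t => op_between F g' t u0)}.

Definition consistent_family (S : op_family) :=
  [/\ forall g t, 0 <= t -> linear (S g t),
      forall g u0, S g 0 u0 = incl g u0
    & forall g g' t (u0 : X g) (u0' : X g'), 0 <= t ->
        incl g u0 = incl g' u0' -> S g t u0 = S g' t u0'].

Definition perturbation_class (S : op_family) (a b : J) (rho : R)
    (P : X a -> X b) :=
  [/\ 0 <= reg_diff a b < 1, smoothing_continuous S b a,
      bounded_operator P & opnorm P <= rho].

Definition scrE (S : op_family) (a : J) : set J :=
  [set g | (regularity g \in `]regularity a - 1, regularity a]) /\
           smoothing_continuous S g a].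

Definition scrR (S : op_family) (b : J) : set J :=
  [set g' | (regularity g' \in `[regularity b, regularity b + 1[) /\
            smoothing_continuous S b g'].

Definition Linfty_loc (a : J) (e : R) : set (R -> X a) :=
  [set phi | strongly_measurable mu (`]0, +oo[) phi /\
     forall T : R, 0 < T ->
       has_ubound ((fun t : R => t `^ e * `|phi t|) @` `]0, T])].

Section Perturbation.
Context (S : op_family) (a : J) (n : nat) (b : 'I_n -> J).
Variable P : forall i, X a -> X (b i).

Definition solves_vcf (g : J) (u0 : X g) (u : R -> X a) :=
  forall t : R, 0 < t -> exists I : 'I_n -> X a,
    (forall i, is_bochner_integral mu (`]0, t[)
       (fun tau : R => op_between S a (t - tau) (P i (u tau))) (I i)) /\
    u t = op_between S a t u0 + \sum_(i < n) I i.

(* Only the values prescribed by the variation of constants formula are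
   constrained: linearity and boundedness of [SP] are not assumed. *)
Definition is_perturbed_family (SP : op_family) :=
  forall (g : J) (u0 : X g), scrE S a g ->
    SP g 0 u0 = incl g u0 /\
    exists u : R -> X a,
      [/\ Linfty_loc (reg_diff a g) u, solves_vcf u0 u
        & forall t, 0 < t -> SP g t u0 = incl a (u t)].

End Perturbation.
End Scale.

Arguments op_family {R} X.

(* Main.v *)
From HB Require Import structures.
From mathcomp Require Import all_boot all_order all_algebra.
From mathcomp Require Import all_classical all_reals all_analysis.
From mathcomp Require Import measurable_realfun.
From mathcomp Require Import ring lra.
Require Import Defs.
Set Implicit Arguments.
Unset Strict Implicit.
Unset Printing Implicit Defensive.
Import Order.TTheory GRing.Theory Num.Theory.
Import numFieldNormedType.Exports.
Local Open Scope classical_set_scope.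
Local Open Scope ring_scope.

(** The function [t |-> S_P(t) u0] is the solution [u] of the integral equation
    [u(t) = S(t) u0 + sum_i int_0^t S(t - x) (P_i u(x)) dx] in [X alpha].  Two
    facts make the theorem true: the operators [S(s)], [s > 0], also map
    [X beta_i] to [X gamma'] with a norm [O(s ^ (- d))], [d < 1], so the
    integrals make sense in [X gamma'] as well; and the values of a Bochner
    integral taken in two spaces of the scale coincide.

    A priori bound.  The kernels [(t - x) ^ (- d)] and the initial singularity
    [x ^ (- e)], [e = d(alpha, gamma) < 1], are integrable, and after
    multiplication by [exp (- l t)] the perturbation terms contract for large
    [l] ([integral_beta_exp]).  Hence [|u(t)| <= C t ^ (- e) |u0|]
    ([mild_solution_bound]), which gives uniqueness, and with it the linearity
    of [S_P(t)].

    Passage to [X gamma'].  If simple functions [v_k] tend to [P_i u] then, with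
    [x] rounded down to a grid, [S(t - grid_k x) (v_k x)] are simple functions
    that tend to [S(t - x) (P_i u x)] simultaneously in [X alpha] and in
    [X gamma'], with integrable majorants ([duhamel_l1_integral]).  Their
    integrals coincide as vectors, so do the limits by topological consistency
    ([duhamel_consistent]), and the integral equation holds in [X gamma']
    ([mild_solution_in_target]).  Inserting the a priori bound, the [i]-th
    integral is [O(t ^ (1 - d(gamma', beta_i) - d(alpha, gamma)))], and this
    exponent is [1 - d(alpha, beta_i) - d(gamma', gamma)], which exceeds
    [- d(gamma', gamma)] ([perturbed_smoothing]).

    Continuity.  An integral [int_0^t S(t - x) w(x) dx] is continuous in [t > 0]:
    cut at a point [c < t], its first part is continuous by dominated
    convergence, and the second one is uniformly small when [t - c] is
    ([duhamel_continuous]).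

    The Bochner integral is handled through [l1_integral], where the [L^1]
    errors of the approximation are controlled by measurable majorants; this
    removes all questions of measurability of the integrand. *)

(** * Simple functions and their integrals *)

Section FinitelyValued.
Context d (T : measurableType d).

(** Simplicity without any structure on the target, so that pairs, indicators
    and their images can be formed freely. *)
Definition finitely_valued (A : Type) (q : T -> A) :=
  finite_set (range q) /\ forall y, measurable (q @^-1` [set y]).

Lemma finitely_valued_preimage (A : Type) (q : T -> A) (Y : set A) :
  finitely_valued q -> measurable (q @^-1` Y).
Proof.
move=> [fq mq].
rewrite (_ : q @^-1` Y = \bigcup_(z in range q `&` Y) q @^-1` [set z]).
  apply: fin_bigcup_measurable => //.
  by apply: sub_finite_set fq => z [].
apply/seteqP; split => [x Yx|x [z [_ Yz] /= ->]//].
by exists (q x) => //; split => //; exists x.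
Qed.

Lemma finitely_valued_comp (A B : Type) (phi : A -> B) (q : T -> A) :
  finitely_valued q -> finitely_valued (phi \o q).
Proof.
move=> fvq; split=> [|y]; last first.
  by rewrite comp_preimage; exact: finitely_valued_preimage.
by rewrite -(image_comp q phi); apply: finite_image; case: fvq.
Qed.

Lemma finitely_valued_pair (A B : Type) (p : T -> A) (q : T -> B) :
  finitely_valued p -> finitely_valued q ->
  finitely_valued (fun x => (p x, q x)).
Proof.
move=> [fp mp] [fq mq]; split.
  apply: (@sub_finite_set _ _ (range p `*` range q)); last exact: finite_setX.
  by move=> _ [x _ <-]; split; exists x.
move=> [a b].
rewrite (_ : _ @^-1` _ = p @^-1` [set a] `&` q @^-1` [set b]).
  exact: measurableI.
by apply/seteqP; split => x /= [-> ->].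
Qed.

Lemma finitely_valued_asbool (A : set T) :
  measurable A -> finitely_valued (fun x => `[< A x >]).
Proof.
move=> mA; split=> [|[]]; first exact: finite_finset.
  by rewrite (_ : _ @^-1` _ = A) //; apply/seteqP; split => x /= /asboolP.
rewrite (_ : _ @^-1` _ = ~` A); first exact: measurableC.
by apply/seteqP; split => x /=; case: asboolP.
Qed.

Lemma finitely_valued_measurable (R : realType) (D : set T) (f : T -> R) :
  measurable D -> finitely_valued f -> measurable_fun D f.
Proof.
by move=> mD fvf _ Y _; apply: measurableI => //; exact: finitely_valued_preimage.
Qed.

End FinitelyValued.

Section SimpleIntegral.
Context d (T : measurableType d) (R : realType).
Variables (mu : {measure set T -> \bar R}) (D : set T).
Hypotheses (mD : measurable D) (finD : (mu D < +oo)%E).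

Let fin_muI (B : set T) : measurable B -> mu (D `&` B) \is a fin_num.
Proof.
move=> mB; rewrite ge0_fin_numE //; apply: le_lt_trans finD.
by apply: le_measure; rewrite ?inE //; exact: measurableI.
Qed.

Lemma measure_fiber_comp (A B : choiceType) (phi : A -> B) (q : T -> A) y :
  finitely_valued q ->
  fine (mu (D `&` (phi \o q) @^-1` [set y])) =
  \sum_(z \in range q) (fine (mu (D `&` q @^-1` [set z])) *+ (phi z == y)).
Proof.
move=> fvq; have [fq mq] := fvq.
pose F z := if phi z == y then D `&` q @^-1` [set z] else set0.
have mF z : measurable (F z).
  by rewrite /F; case: ifP => // _; exact: measurableI.
rewrite (_ : D `&` _ = \bigcup_(z in range q) F z); last first.
  apply/seteqP; split => [x /= [Dx yE]|x [z _]].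
    by exists (q x); [exists x|rewrite /F -yE eqxx].
  by rewrite /F; case: ifPn => [/eqP <- [Dx /= ->]|].
rewrite -fsbig_setU // measure_fsbig //; last first.
  move=> z1 z2 _ _ [x []]; rewrite /F.
  by do 2 case: ifP => // _; move=> [_ /= qz1] [_ /= qz2]; rewrite -qz1 -qz2.
rewrite !fsbig_finite //= -sum_fine => [|z _]; last first.
  by rewrite /F; case: ifP => _; [exact: fin_muI|rewrite measure0].
by apply: eq_bigr => z _; rewrite /F; case: ifP; rewrite ?measure0.
Qed.

(** A common refinement computes the integral of every function that factors
    through it; all the algebra of simple integrals follows by taking for the
    refinement a pair of simple functions. *)
Lemma simple_integral_comp (E : normedModType R) (A : choiceType)
    (phi : A -> E) (q : T -> A) : finitely_valued q ->
  simple_integral mu D (phi \o q) =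
  \sum_(z \in range q) fine (mu (D `&` q @^-1` [set z])) *: phi z.
Proof.
move=> fvq; have [fq mq] := fvq.
have [fpq _] := finitely_valued_comp phi fvq.
rewrite /simple_integral.
transitivity (\sum_(y \in range (phi \o q)) \sum_(z \in range q)
    ((fine (mu (D `&` q @^-1` [set z])) *+ (phi z == y)) *: y)).
  apply: eq_fsbigr => y _.
  by rewrite (measure_fiber_comp _ _ fvq) !fsbig_finite //= scaler_suml.
rewrite exchange_fsbig //; apply: eq_fsbigr => z /set_mem [x _ <-{z}].
rewrite -(fsbig_widen [set phi (q x)]) => [|_ -> |y [_ /=]]; last 2 first.
- by exists x.
- by move/eqP; rewrite eq_sym => /negbTE ->; rewrite mulr0n scale0r.
by rewrite fsbig_set1 eqxx.
Qed.

Section Algebra.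
Context (E : normedModType R).
Implicit Types (s : T -> E).

Lemma simple_integral_linear (a : R) s1 s2 :
  simple_function s1 -> simple_function s2 ->
  simple_integral mu D (fun x => a *: s1 x + s2 x) =
  a *: simple_integral mu D s1 + simple_integral mu D s2.
Proof.
move=> f1 f2; pose q x := (s1 x, s2 x).
have fvq : finitely_valued q by exact: finitely_valued_pair.
have [fq _] := fvq.
rewrite (@simple_integral_comp _ _ (fun z => a *: z.1 + z.2) q) //.
rewrite (@simple_integral_comp _ _ fst q) //.
rewrite (@simple_integral_comp _ _ snd q) //.
rewrite !fsbig_finite //= scaler_sumr -big_split; apply: eq_bigr => z _ /=.
by rewrite scalerDr !scalerA mulrC.
Qed.

Lemma simple_integral_restrict s (B : set T) : B `<=` D ->
  simple_integral mu D (fun x => if `[< B x >] then s x else 0) =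
  simple_integral mu B s.
Proof.
move=> BD; set s' := fun x => _.
have s'E y : y != 0 -> D `&` s' @^-1` [set y] = B `&` s @^-1` [set y].
  move=> y0; apply/seteqP; split => x /= [Dx]; rewrite /s'.
    by case: asboolP => // _ y0'; rewrite -y0' eqxx in y0.
  by move=> sxy; split; [exact: BD|rewrite asboolT].
rewrite /simple_integral.
rewrite (fsbig_widen _ (range s' `|` range s)); last 2 first.
- by move=> y; left.
- move=> y [_ /= ys']; rewrite (_ : _ `&` _ = set0).
    by rewrite measure0 scale0r.
  by apply/seteqP; split => // x [_ /= xy]; apply: ys'; exists x.
rewrite [RHS](fsbig_widen _ (range s' `|` range s)); last 2 first.
- by move=> y; right.
- move=> y [_ /= ys']; rewrite (_ : _ `&` _ = set0).
    by rewrite measure0 scale0r.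
  by apply/seteqP; split => // x [_ /= xy]; apply: ys'; exists x.
apply: eq_fsbigr => y _; have [->|y0] := eqVneq y 0; first by rewrite !scaler0.
by rewrite s'E.
Qed.

Lemma simple_function_norm s : simple_function s ->
  finitely_valued (fun x => `|s x|).
Proof. exact: finitely_valued_comp. Qed.

Lemma norm_simple_integral s : simple_function s ->
  (`|simple_integral mu D s|%:E <= \int[mu]_(x in D) `|s x|%:E)%E.
Proof.
move=> fs; have [fs0 ms] := fs.
have -> : (\int[mu]_(x in D) `|s x|%:E =
    \int[mu]_(x in D) (\sum_(y \in range s) (\1_(s @^-1` [set y]) x * `|y|)%:E))%E.
  apply: eq_integral => x _; rewrite -(fsbig_widen [set s x]).
  - by rewrite fsbig_set1 indicE mem_set // mul1r.
  - by move=> _ ->; exists x.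
  - move=> y [_ /= ysx]; rewrite indicE memNset ?mul0r // => /= sxy.
    by apply: ysx.
rewrite ge0_integral_fsum //; last first.
  by move=> y; apply/measurable_EFinP/measurable_funM.
have lenorm : (`|simple_integral mu D s|%:E <=
    \sum_(y \in range s)
       (fine (mu (D `&` s @^-1` [set y])) * `|y|)%:E)%E.
  rewrite /simple_integral !fsbig_finite //= sumEFin lee_fin.
  apply: le_trans (ler_norm_sum _ _ _) _.
  by apply: ler_sum => y _; rewrite normrZ ger0_norm // fine_ge0.
apply: (le_trans lenorm); rewrite !fsbig_finite //=.
apply: lee_sum => y _.
rewrite (eq_integral (fun x => `|y|%:E * (\1_(s @^-1` [set y]) x)%:E)%E); last first.
  by move=> x _; rewrite -EFinM mulrC.
rewrite ge0_integralZl //; last first.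
  by apply/measurable_EFinP; exact: measurable_indic.
by rewrite integral_indic // [_ `&` D]setIC mulrC EFinM fineK ?fin_muI.
Qed.

End Algebra.
End SimpleIntegral.

(** * Bochner integrals with measurable errors *)

Section LowerIntegral.
Local Open Scope ereal_scope.
Context d (T : measurableType d) (R : realType).
Variable mu : {measure set T -> \bar R}.

(** The integral of a nonnegative function is a supremum over the simple
    functions below it, which is monotone in the domain without measurability.
    The errors in the definition of the Bochner integral need this generality,
    their integrand being arbitrary on a null set. *)
Lemma ge0_subset_integral_nonmeasurable (A D : set T) (f : T -> \bar R) :
  A `<=` D -> (forall x, D x -> 0 <= f x) ->
  \int[mu]_(x in A) f x <= \int[mu]_(x in D) f x.
Proof.
move=> AD f0; rewrite !ge0_integralE //; last by move=> x /AD /f0.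
apply: ereal_sup_le => _ [h hf <-]; exists h => // x.
apply: le_trans (hf x) _; rewrite !patchE.
case: ifPn => [/set_mem/AD Dx|_]; first by rewrite mem_set.
by case: ifPn => // /set_mem/f0.
Qed.

End LowerIntegral.

Section L1Integral.
Context d (T : measurableType d) (R : realType) (E : normedModType R).
Variable mu : {measure set T -> \bar R}.

(** The majorants [g n] take extended values so that an exceptional null set can
    be absorbed by the value [+oo].  Being measurable they can be added under the
    integral, which the norms [`|f x - s n x|] need not allow. *)
Definition l1_integral (D : set T) (f : T -> E) (I : E) :=
  exists (s : nat -> T -> E) (g : nat -> T -> \bar R),
  [/\ forall n, simple_function (s n), forall n, measurable_fun D (g n),
      forall n x, D x -> (`|f x - s n x|%:E <= g n x)%E,
      (\int[mu]_(x in D) g n x)%E @[n --> \oo] --> 0%E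
    & simple_integral mu D (s n) @[n --> \oo] --> I].

Lemma l1_integral_ext D f f' I : (forall x, D x -> f x = f' x) ->
  l1_integral D f I -> l1_integral D f' I.
Proof.
move=> ff' [s [g [ss mg fg g0 sI]]]; exists s, g; split => // n x Dx.
by rewrite -ff' //; exact: fg.
Qed.

Section Basic.
Variable D : set T.
Hypotheses (mD : measurable D) (finD : (mu D < +oo)%E).

Lemma l1_integral_norm f I (h : T -> \bar R) : l1_integral D f I ->
  measurable_fun D h -> (forall x, D x -> (`|f x|%:E <= h x)%E) ->
  (`|I|%:E <= \int[mu]_(x in D) h x)%E.
Proof.
move=> [s [g [ss mg fg g0 sI]]] mh fh.
have g_ge0 n x : D x -> (0 <= g n x)%E.
  by move=> Dx; apply: le_trans (fg n x Dx); rewrite lee_fin.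
have h_ge0 x : D x -> (0 <= h x)%E.
  by move=> Dx; apply: le_trans (fh x Dx); rewrite lee_fin.
have Inorm : `|simple_integral mu D (s n)|%:E @[n --> \oo] --> `|I|%:E.
  by apply: cvg_EFin; [exact: nearW|exact: cvg_norm].
have cvgh : (\int[mu]_(x in D) g n x + \int[mu]_(x in D) h x)%E
    @[n --> \oo] --> (0 + \int[mu]_(x in D) h x)%E.
  by apply: cvgeD => //; exact: cvg_cst.
rewrite add0e in cvgh; apply: (lee_cvg_to Inorm cvgh); apply: nearW => n.
apply: le_trans (norm_simple_integral mD finD (ss n)) _.
rewrite -(ge0_integralD mu mD (@g_ge0 n) (mg n) h_ge0 mh).
apply: ge0_le_integral => //.
- apply/measurable_EFinP; apply: finitely_valued_measurable => //.
  exact: (simple_function_norm (ss n)).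
- exact: emeasurable_funD.
- move=> x Dx; apply: le_trans (leeD (fg n x Dx) (fh x Dx)).
  by rewrite -EFinD lee_fin -[X in `|X| <= _](subrK (f x)) distrC ler_normD.
Qed.

Lemma l1_integral_linear (a : R) f I f' I' :
  l1_integral D f I -> l1_integral D f' I' ->
  l1_integral D (fun x => a *: f x + f' x) (a *: I + I').
Proof.
move=> [s [g [ss mg fg g0 sI]]] [s' [g' [ss' mg' fg' g0' sI']]].
exists (fun n x => a *: s n x + s' n x), (fun n x => `|a|%:E * g n x + g' n x)%E.
have g_ge0 n x : D x -> (0 <= g n x)%E.
  by move=> Dx; apply: le_trans (fg n x Dx); rewrite lee_fin.
have g'_ge0 n x : D x -> (0 <= g' n x)%E.
  by move=> Dx; apply: le_trans (fg' n x Dx); rewrite lee_fin.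
have mag n : measurable_fun D (fun x => `|a|%:E * g n x)%E.
  exact: measurable_funeM.
split.
- move=> n; exact: (finitely_valued_comp (fun z => a *: z.1 + z.2)
    (finitely_valued_pair (ss n) (ss' n))).
- by move=> n; exact: emeasurable_funD.
- move=> n x Dx; apply: le_trans (leeD (lee_wpmul2l _ (fg n x Dx)) (fg' n x Dx)).
    rewrite -EFinM -EFinD lee_fin -normrZ scalerBr.
    by apply: le_trans (ler_normD _ _); rewrite opprD addrACA.
  by rewrite lee_fin.
- have -> : 0%E = (`|a|%:E * 0 + 0 :> \bar R)%E by rewrite mule0 adde0.
  rewrite [X in X @ _ --> _](_ : _ = fun n => (`|a|%:E * \int[mu]_(x in D) g n x
      + \int[mu]_(x in D) g' n x)%E).
    by apply: cvgeD => //; exact: cvgeZl.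
  have ag_ge0 n x : D x -> (0 <= `|a|%:E * g n x)%E.
    by move=> Dx; rewrite mule_ge0 // g_ge0.
  apply/funext => n.
  rewrite (ge0_integralD mu mD (@ag_ge0 n) (mag n) (@g'_ge0 n) (mg' n)).
  by rewrite (ge0_integralZl mu mD (mg n) (@g_ge0 n)).
- rewrite [X in X @ _ --> _](_ : _ = fun n => a *: simple_integral mu D (s n) +
      simple_integral mu D (s' n)).
    by apply: cvgD => //; exact: cvgZr.
  by apply/funext => n; rewrite simple_integral_linear.
Qed.

Lemma l1_integral_unique f I I' :
  l1_integral D f I -> l1_integral D f I' -> I = I'.
Proof.
move=> fI fI'; have /l1_integral_norm := l1_integral_linear (-1) fI fI'.
move=> /(_ (cst 0%E)) /(_ _ _)/wrap[]; first exact: measurable_cst.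
  by move=> x Dx; rewrite scaleN1r addNr normr0.
rewrite integral0 lee_fin normr_le0 scaleN1r addrC subr_eq0 => /eqP ->.
by [].
Qed.

(** Errors set to [+oo] on a null set have unchanged integrals. *)
Lemma l1_integral_ae_ext (N : set T) f f' I :
  measurable N -> mu N = 0%E -> (forall x, D x -> ~ N x -> f x = f' x) ->
  l1_integral D f I -> l1_integral D f' I.
Proof.
move=> mN N0 ff' [s [g [ss mg fg g0 sI]]].
have g_ge0 n x : D x -> (0 <= g n x)%E.
  by move=> Dx; apply: le_trans (fg n x Dx); rewrite lee_fin.
pose g' n x := if `[< N x >] then +oo%E else g n x.
have g'_ge0 n x : D x -> (0 <= g' n x)%E.
  by move=> Dx; rewrite /g'; case: ifP => // _; exact: g_ge0.
have mg' n : measurable_fun D (g' n).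
  apply: measurable_fun_if => //.
  - move=> _ Y _; apply: measurableI => //; apply: finitely_valued_preimage.
    exact: finitely_valued_asbool.
  - exact: measurable_funS (mg n).
exists s, g'; split => //.
- move=> n x Dx; rewrite /g'; case: asboolP => Nx; first by rewrite leey.
  by rewrite -ff' //; exact: fg.
- rewrite [X in X @ _ --> _](_ : _ = fun n => \int[mu]_(x in D) g n x)%E //.
  apply/funext => n; rewrite (ge0_negligible_integral mN mD (mg' n) (g'_ge0 n) N0).
  rewrite [RHS](ge0_negligible_integral mN mD (mg n) (g_ge0 n) N0).
  by apply: eq_integral => x /set_mem[_ Nx]; rewrite /g' asboolF.
Qed.

(** Redefining the error as [+oo] on the exceptional null set keeps it
    measurable although [f] is arbitrary there. *)
Lemma measurable_patched_error (N : set T) (f : T -> E) (s : T -> E) sm :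
  measurable N -> simple_function s -> (forall k, simple_function (sm k)) ->
  (forall x, D x -> ~ N x -> sm k x @[k --> \oo] --> f x) ->
  measurable_fun D (fun x => if `[< N x >] then +oo%E else `|f x - s x|%:E).
Proof.
move=> mN ss ssm smf.
apply: (@emeasurable_fun_cvg _ _ _ _ (fun k x =>
  if `[< N x >] then +oo%E else `|sm k x - s x|%:E)) => [k|x Dx].
  apply: measurable_funTS => /=.
  have fvq := finitely_valued_pair (finitely_valued_asbool mN)
    (finitely_valued_pair (ssm k) ss).
  have fve := finitely_valued_comp (fun z : bool * (E * E) =>
    if z.1 then +oo%E else `|z.2.1 - z.2.2|%:E) fvq.
  by move=> _ Y _; rewrite setTI; exact: finitely_valued_preimage.
case: asboolP => Nx; first exact: cvg_cst.
apply: cvg_EFin; first exact: nearW.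
by apply: cvg_norm; apply: cvgB; [exact: smf|exact: cvg_cst].
Qed.

(** Off the null set where the simple approximations of [f] diverge, the error
    is itself a measurable function. *)
Lemma is_bochner_l1_integral f I : is_bochner_integral mu D f I ->
  l1_integral D f I.
Proof.
move=> [[sm [ssm [N [mN N0 smN]]]] [s [ss s0 sI]]].
exists s, (fun n x => if `[< N x >] then +oo%E else `|f x - s n x|%:E).
have conv x : D x -> ~ N x -> sm k x @[k --> \oo] --> f x.
  by move=> Dx; apply: contra_notP => nconv; apply: smN => /(_ Dx).
have me n := measurable_patched_error mN (proj1 (ss n)) ssm conv.
split => //.
- by move=> n; exact: (proj1 (ss n)).
- by move=> n x Dx; case: ifP => // _; rewrite leey.
- apply: squeeze_cvge (cvg_cst 0%E) s0; apply: nearW => n.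
  have e_ge0 x : (0 <= if `[< N x >] then +oo%E else `|f x - s n x|%:E)%E.
    by case: ifP => // _; rewrite ?lee_fin ?leey.
  apply/andP; split; first by apply: integral_ge0 => x _.
  rewrite (ge0_negligible_integral mN) //.
  apply: le_trans (_ : _ <= \int[mu]_(x in D `\` N) `|f x - s n x|%:E)%E _.
    rewrite le_eqVlt; apply/orP; left; apply/eqP.
    by apply: eq_integral => x /set_mem[_ Nx]; rewrite asboolF.
  by apply: ge0_subset_integral_nonmeasurable => // x [].
Qed.

End Basic.

Lemma l1_integral_restrict (B D : set T) f I : measurable B -> measurable D ->
  B `<=` D -> l1_integral B f I ->
  l1_integral D (fun x => if `[< B x >] then f x else 0) I.
Proof.
move=> mB mD BD [s [g [ss mg fg g0 sI]]].
exists (fun n x => if `[< B x >] then s n x else 0), (fun n => g n \_ B).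
split.
- move=> n; exact: (finitely_valued_comp (fun z => if z.1 then z.2 else 0)
    (finitely_valued_pair (finitely_valued_asbool mB) (ss n))).
- move=> n; apply/(measurable_restrict _ mB mD).1.
  by rewrite setIidr.
- move=> n x Dx; rewrite patchE; case: asboolP => Bx.
    by rewrite mem_set //; exact: fg.
  by rewrite memNset // subrr normr0.
- rewrite [X in X @ _ --> _](_ : _ = fun n => \int[mu]_(x in B) g n x)%E //.
  apply/funext => n; rewrite integral_mkcond [RHS]integral_mkcond.
  congr integral; apply/funext => x; rewrite !patchE.
  case: (boolP (x \in B)) => Bx; last by rewrite if_same.
  by rewrite mem_set //; apply: BD; exact: set_mem.
- rewrite [X in X @ _ --> _](_ : _ = fun n => simple_integral mu B (s n)) //.
  by apply/funext => n; rewrite simple_integral_restrict.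
Qed.

End L1Integral.

Section Dominated.
Context d (T : measurableType d) (R : realType) (E : completeNormedModType R).
Variables (mu : {measure set T -> \bar R}) (D : set T).
Hypotheses (mD : measurable D) (finD : (mu D < +oo)%E).

(** Dominated convergence for simple approximations: it supplies both the
    existence of the integral and the approximating sums that converge to it. *)
Lemma l1_integral_dominated (N : set T) (f : T -> E) s (h : T -> R) :
  measurable N -> mu N = 0%E -> (forall k, simple_function (s k)) ->
  (forall x, D x -> ~ N x -> s k x @[k --> \oo] --> f x) ->
  mu.-integrable D (EFin \o h) ->
  (forall k x, D x -> ~ N x -> `|s k x| <= h x) ->
  exists2 I, l1_integral mu D f I &
    simple_integral mu D (s k) @[k --> \oo] --> I.
Proof.
move=> mN N0 ss sf ih sh.
pose g n x := if `[< N x >] then +oo%E else `|f x - s n x|%:E.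
have mg n : measurable_fun D (g n).
  exact: (measurable_patched_error mN (ss n) ss sf).
have g_ge0 n x : (0 <= g n x)%E.
  by rewrite /g; case: ifP => // _; rewrite ?lee_fin ?leey.
have fg n x : D x -> (`|f x - s n x|%:E <= g n x)%E.
  by rewrite /g; case: ifP => // _; rewrite leey.
have fh x : D x -> ~ N x -> `|f x| <= h x.
  move=> Dx Nx; apply: (cvgr_to_le (cvg_norm (sf x Dx Nx))).
  by apply: nearW => k; exact: sh.
have notN : {ae mu, forall x, ~ N x}.
  by exists N; split => // x /= /contrapT.
have g0 : (\int[mu]_(x in D) g n x)%E @[n --> \oo] --> 0%E.
  have [||||_ _] := @dominated_convergence _ _ _ mu D mD g (cst 0%E)
      (EFin \o (fun x => 2 * h x)) mg.
  - exact: measurable_cst.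
  - apply: filterS notN => x Nx Dx; rewrite /g asboolF //.
    apply: cvg_EFin; first exact: nearW.
    have -> : (0 : R) = `|f x - f x| by rewrite subrr normr0.
    by apply: cvg_norm; apply: cvgB; [exact: cvg_cst|exact: sf].
  - rewrite (_ : _ \o _ = (fun x => 2%:E * (EFin \o h) x)%E).
      exact: integrableZl.
    by apply/funext => x /=; rewrite EFinM.
  - apply: filterS notN => x Nx n Dx; rewrite /g asboolF //= normr_id lee_fin.
    by rewrite mulr_natl mulr2n; apply: le_trans (ler_normB _ _) (lerD _ _);
      [exact: fh|exact: sh].
  by rewrite integral0.
have lt_near e : 0 < e -> \forall k \near \oo, (\int[mu]_(x in D) g k x < e%:E)%E.
  move=> e0; have /fine_cvgP[fing g0'] := g0.
  have lte : \forall k \near \oo, fine (\int[mu]_(x in D) g k x)%E < e.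
    by apply: (cvgr_lt (0 : R)).
  by apply: filterS2 fing lte => k fink; rewrite -lte_fin fineK.
have cvgI : cvg (simple_integral mu D (s k) @[k --> \oo]).
  apply/cauchy_cvgP/cauchy_exP => e e0.
  have [k0 _ lek0] := lt_near _ (divr_gt0 e0 (ltr0Sn R 1)).
  exists (simple_integral mu D (s k0)); exists k0 => // k /= k0k.
  rewrite -ball_normE /= -lte_fin.
  have -> : simple_integral mu D (s k0) - simple_integral mu D (s k) =
      simple_integral mu D (fun x => -1 *: s k x + s k0 x).
    by rewrite simple_integral_linear // scaleN1r addrC.
  have skk0 : simple_function (fun x => -1 *: s k x + s k0 x).
    exact: (finitely_valued_comp (fun z => -1 *: z.1 + z.2)
      (finitely_valued_pair (ss k) (ss k0))).
  apply: le_lt_trans (norm_simple_integral mD finD skk0) _.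
  apply: (@le_lt_trans _ _ (\int[mu]_(x in D) (g k x + g k0 x))%E).
    apply: ge0_le_integral => //.
    - apply/measurable_EFinP; apply: finitely_valued_measurable => //.
      exact: (simple_function_norm skk0).
    - exact: emeasurable_funD.
    - move=> x Dx; apply: le_trans (leeD (fg k x Dx) (fg k0 x Dx)).
      rewrite -EFinD lee_fin scaleN1r (addrC (- s k x)) [X in _ <= X]addrC.
      by rewrite (distrC (f x) (s k0 x)); exact: ler_distD.
  rewrite ge0_integralD // [e]splitr EFinD.
  by apply: lteD; apply: lek0 => /=.
exists (lim (simple_integral mu D (s k) @[k --> \oo])) => //.
by exists s, g.
Qed.

End Dominated.

(** * Integrals of singular kernels *)

Section PowerIntegrals.
Context (R : realType).
Local Notation mu := (@lebesgue_measure R).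

(** Exhausting the open interval by compact ones lets [f] blow up at the
    endpoints, and the monotonicity of the primitive bounds every stage. *)
Lemma integral_le_primitive (F f : R -> R) (a b : R) : a < b ->
  (forall x, a < x < b -> is_derive (x : R) (1 : R) F (f x)) ->
  (forall x, a < x < b -> {for x, continuous f}) ->
  (forall x, a < x < b -> 0 <= f x) ->
  {in `[a, b] &, {homo F : x y / x <= y}} ->
  (\int[mu]_(x in `]a, b[) (f x)%:E <= (F b - F a)%:E)%E.
Proof.
move=> ab dF cf f0 ndF.
pose e (n : nat) := (b - a) / n.+3%:R.
have e0 n : 0 < e n by rewrite divr_gt0 ?subr_gt0.
have en m n : (m <= n)%N -> e n <= e m.
  move=> mn; rewrite /e ler_pM2l ?subr_gt0 // lef_pV2 ?posrE // ler_nat.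
  by rewrite !ltnS.
have eab n : a + e n < b - e n.
  have n3 : (n.+3%:R : R)^-1 < 2^-1 by rewrite ltf_pV2 ?posrE // ltr_nat.
  have : e n < (b - a) * 2^-1 by rewrite /e ltr_pM2l ?subr_gt0.
  lra.
pose K n := `[a + e n, b - e n]%classic.
have Kab n x : K n x -> a < x < b.
  rewrite /K /= in_itv /= => /andP[ax xb]; have := e0 n.
  by move=> en0; apply/andP; split; lra.
have Kcup : \bigcup_n K n = `]a, b[%classic.
  apply/seteqP; split => x /=.
    by move=> [n _ /Kab]; rewrite in_itv.
  rewrite in_itv /= => /andP[ax xb].
  have d0 : 0 < Num.min (x - a) (b - x) by rewrite lt_min !subr_gt0 ax.
  have ba0 : 0 < b - a by rewrite subr_gt0.
  have [n _ ltn] := near_infty_natSinv_lt (PosNum (divr_gt0 d0 ba0)).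
  have {}ltn : e n < Num.min (x - a) (b - x).
    rewrite /e mulrC -ltr_pdivlMr //; apply: le_lt_trans (ltn n (leqnn n)).
    by rewrite lef_pV2 ?posrE // ler_nat ltnS leqW // leqW.
  move: ltn; rewrite lt_min => /andP[? ?].
  by exists n => //; rewrite /K /= in_itv /=; apply/andP; split; lra.
have cvgK : (\int[mu]_(x in K n) (f x)%:E)%E @[n --> \oo] -->
    (\int[mu]_(x in \bigcup_n K n) (f x)%:E)%E.
  apply: ge0_nondecreasing_set_cvg_integral.
  - move=> m n mn; apply/subsetPset => x; rewrite /K /= !in_itv /= => /andP[ax xb].
    by have := en _ _ mn => emn; apply/andP; split; lra.
  - by move=> n; exact: measurable_itv.
  - move=> n; apply/measurable_EFinP.
    apply: subspace_continuous_measurable_fun; first exact: measurable_itv.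
    by apply: continuous_in_subspaceT => x /set_mem/Kab; exact: cf.
  - by move=> n x /Kab/f0; rewrite lee_fin.
rewrite -Kcup; apply: (cvge_to_le cvgK); apply: nearW => n.
have cF x : a < x < b -> {for x, continuous F}.
  move=> xab; apply/differentiable_continuous/derivable1_diffP.
  by have [] := dF x xab.
have inab x : a + e n <= x <= b - e n -> a < x < b.
  by move=> h; apply: (Kab n); rewrite /K /= in_itv.
rewrite (continuous_FTC2 (F := F)) //.
- rewrite -EFinB lee_fin lerB // ndF //; rewrite ?in_itv /=; have := e0 n;
    have := eab n; lra.
- by apply: continuous_in_subspaceT => x /set_mem/Kab; exact: cf.
- split.
  + move=> x; rewrite in_itv /= => /andP[/ltW ax /ltW xb].
    by have [] := dF x (inab x _); rewrite ?ax.
  + apply: cvg_at_right_filter; apply: cF; apply: inab.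
    by rewrite lexx ltW.
  + apply: cvg_at_left_filter; apply: cF; apply: inab.
    by rewrite lexx ltW.
- move=> x; rewrite in_itv /= => /andP[/ltW ax /ltW xb].
  by rewrite derive1E; have [_] := dF x (inab x (introT andP (conj ax xb))).
Qed.

Lemma continuous_powR_pos (r x : R) : 0 < x ->
  {for x, continuous (fun y => y `^ r)}.
Proof.
move=> x0; apply/differentiable_continuous/derivable1_diffP.
by have [] := is_derive1_powR r x0.
Qed.

Lemma measurable_powR_sub (t d : R) (D : set R) :
  measurable_fun D (fun x => (t - x) `^ d).
Proof.
apply: measurable_funTS; apply: (measurableT_comp (measurable_powR _)).
exact: measurable_funB.
Qed.

Lemma integral_powR_tail (c t d : R) : c < t -> d < 1 ->
  (\int[mu]_(x in `]c, t[) ((t - x) `^ (- d))%:E <=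
   ((t - c) `^ (1 - d) / (1 - d))%:E)%E.
Proof.
move=> ct d1; have d1' : 0 < 1 - d by rewrite subr_gt0.
pose F x := - ((t - x) `^ (1 - d) / (1 - d)).
apply: le_trans (integral_le_primitive (F := F) ct _ _ _ _) _.
- move=> x /andP[cx xt]; have tx : 0 < t - x by rewrite subr_gt0.
  have dsub : is_derive (x : R) (1 : R) (fun y => t - y) (-1).
    by have := is_deriveB (is_derive_cst t x 1) (is_derive_id x (1 : R)); rewrite sub0r.
  have dpow := @is_derive1_powR R (1 - d) _ tx.
  have dcomp := @is_derive1_comp R (fun y => y `^ (1 - d)) _ x _ _ dpow dsub.
  have -> : F = - ((1 - d)^-1 \*: ((fun y => y `^ (1 - d)) \o (fun y => t - y))).
    by apply/funext => y; rewrite /F /= mulrC.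
  have -> : (t - x) `^ (- d) =
      - ((1 - d)^-1 *: ((1 - d) * (t - x) `^ (1 - d - 1) * -1)).
    rewrite (_ : 1 - d - 1 = - d); last by ring.
    by rewrite /GRing.scale /= mulrN1 mulrN opprK mulKf ?gt_eqF.
  by apply: is_deriveN; apply: is_deriveZ.
- move=> x /andP[cx xt]; have tx : 0 < t - x by rewrite subr_gt0.
  apply: (@continuous_comp _ _ _ (fun y => t - y) (fun y => y `^ (- d))).
    by apply: cvgB; [exact: cvg_cst|exact: cvg_id].
  exact: continuous_powR_pos.
- by move=> x _; exact: powR_ge0.
- move=> x y; rewrite !in_itv /= => /andP[cx xt] /andP[cy yt] xy.
  rewrite /F lerN2 ler_pM2r ?invr_gt0 //.
  by apply: ge0_ler_powR; rewrite ?nnegrE; lra.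
- by rewrite lee_fin /F subrr powR0 ?gt_eqF // mul0r oppr0 sub0r opprK.
Qed.

Lemma integral_powR_head (t e : R) : 0 < t -> e < 1 ->
  (\int[mu]_(x in `]0%R, t[) (x `^ (- e))%:E <= (t `^ (1 - e) / (1 - e))%:E)%E.
Proof.
move=> t0 e1; have e1' : 0 < 1 - e by rewrite subr_gt0.
pose F x := (x `^ (1 - e) / (1 - e)).
apply: le_trans (integral_le_primitive (F := F) t0 _ _ _ _) _.
- move=> x /andP[x0 xt]; have dpow := @is_derive1_powR R (1 - e) _ x0.
  have -> : F = (1 - e)^-1 \*: (fun y => y `^ (1 - e)).
    by apply/funext => y; rewrite /F /= mulrC.
  have -> : x `^ (- e) = (1 - e)^-1 *: ((1 - e) * x `^ (1 - e - 1)).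
    rewrite (_ : 1 - e - 1 = - e); last by ring.
    by rewrite /GRing.scale /= mulKf ?gt_eqF.
  exact: is_deriveZ.
- by move=> x /andP[x0 xt]; exact: continuous_powR_pos.
- by move=> x _; exact: powR_ge0.
- move=> x y; rewrite !in_itv /= => /andP[cx xt] /andP[cy yt] xy.
  rewrite /F ler_pM2r ?invr_gt0 //.
  by apply: ge0_ler_powR; rewrite ?nnegrE; lra.
- by rewrite lee_fin /F powR0 ?gt_eqF // mul0r subr0.
Qed.

(** An explicit majorant of the Beta function at [(1 - e, 1 - d)]. *)
Definition beta_bound (d e : R) := 2 `^ d / (1 - e) + 2 `^ e / (1 - d).

Lemma beta_bound_ge0 d e : d < 1 -> e < 1 -> 0 <= beta_bound d e.
Proof.
by move=> d1 e1; rewrite addr_ge0 // divr_ge0 ?powR_ge0 // subr_ge0 ltW.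
Qed.

Lemma powR_mul_le_split (t x d e : R) : 0 <= d -> 0 <= e -> 0 < x < t ->
  (t - x) `^ (- d) * x `^ (- e) <=
  (t / 2) `^ (- d) * x `^ (- e) + (t / 2) `^ (- e) * (t - x) `^ (- d).
Proof.
move=> d0 e0 /andP[x0 xt].
have anti u v r : 0 <= r -> 0 < u -> u <= v -> v `^ (- r) <= u `^ (- r).
  move=> r0 u0 uv; rewrite !powRN lef_pV2 ?posrE ?powR_gt0 ?(lt_le_trans u0) //.
  by rewrite ge0_ler_powR // ?nnegrE ?ltW // (lt_le_trans u0).
have [xt2|xt2] := leP x (t / 2).
- rewrite -[leLHS]addr0 lerD ?mulr_ge0 ?powR_ge0 //.
  by rewrite ler_wpM2r ?powR_ge0 // anti //; lra.
- rewrite -[leLHS]add0r lerD ?mulr_ge0 ?powR_ge0 // mulrC.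
  by rewrite ler_wpM2r ?powR_ge0 // anti //; lra.
Qed.

(** The two singularities are at distance [t], so at each point one of the two
    factors is controlled by its value at the midpoint. *)
Lemma integral_beta (t d e : R) : 0 < t -> 0 <= d < 1 -> 0 <= e < 1 ->
  (\int[mu]_(x in `]0%R, t[) ((t - x) `^ (- d) * x `^ (- e))%:E <=
   (beta_bound d e * t `^ (1 - d - e))%:E)%E.
Proof.
move=> t0 /andP[d0 d1] /andP[e0 e1].
have mpow r (D : set R) : measurable_fun D (fun x : R => x `^ r).
  by apply: measurable_funTS; exact: measurable_powR.
have msub r := @measurable_powR_sub t r.
have mker r r' (D : set R) : measurable_fun D (fun x : R => (t - x) `^ r * x `^ r').
  exact: measurable_funM (msub r D) (mpow r' D).
have mpowE r (D : set R) : measurable_fun D (fun x : R => (x `^ r)%:E).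
  by apply/measurable_EFinP; exact: mpow.
have msubE r (D : set R) : measurable_fun D (fun x : R => ((t - x) `^ r)%:E).
  by apply/measurable_EFinP; exact: msub.
apply: (@le_trans _ _ (\int[mu]_(x in `]0%R, t[) (((t / 2) `^ (- d))%:E * (x `^ (- e))%:E
   + ((t / 2) `^ (- e))%:E * ((t - x) `^ (- d))%:E))%E).
  apply: ge0_le_integral => //.
  - by move=> x _; rewrite lee_fin mulr_ge0 ?powR_ge0.
  - by apply/measurable_EFinP; exact: mker.
  - by apply: emeasurable_funD; apply: measurable_funeM; [exact: mpowE|exact: msubE].
  - move=> x; rewrite /= in_itv /= => xt.
    by rewrite -!EFinM -EFinD lee_fin powR_mul_le_split.
have pow0 u r : (0 <= (u `^ r)%:E)%E by rewrite lee_fin powR_ge0.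
rewrite ge0_integralD //; first last.
- by apply: measurable_funeM; exact: msubE.
- by move=> x _; rewrite mule_ge0.
- by apply: measurable_funeM; exact: mpowE.
- by move=> x _; rewrite mule_ge0.
rewrite (ge0_integralZl mu _ (mpowE _ _)) // (ge0_integralZl mu _ (msubE _ _)) //.
apply: (@le_trans _ _ (((t / 2) `^ (- d))%:E * (t `^ (1 - e) / (1 - e))%:E +
   ((t / 2) `^ (- e))%:E * (t `^ (1 - d) / (1 - d))%:E)%E).
  apply: leeD; (apply: lee_wpmul2l; first exact: pow0).
    exact: integral_powR_head.
  by have := integral_powR_tail t0 d1; rewrite subr0.
rewrite -!EFinM -EFinD lee_fin /beta_bound le_eqVlt; apply/orP; left; apply/eqP.
have half r : (t / 2) `^ (- r) = 2 `^ r * t `^ (- r).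
  by rewrite powRM ?ltW // ?invr_ge0 // mulrC -powR_inv1 // -powRrM mulrNN mul1r.
have tD r r' : t `^ (r + r') = t `^ r * t `^ r'.
  by rewrite powRD //; apply/implyP => _; rewrite gt_eqF.
rewrite !half !tD; ring.
Qed.

Lemma powR_le_expR (x a : R) : 0 <= x -> 0 <= a <= 1 -> x `^ a <= expR x.
Proof.
move=> x0 /andP[a0 a1]; have [x1|/ltW x1] := leP x 1.
  apply: (@le_trans _ _ (1 `^ a)); last by rewrite powR1 -expR0 ler_expR.
  by apply: ge0_ler_powR; rewrite ?nnegrE.
apply: le_trans (ler1_powR x1 a1) _.
by apply: le_trans (expR_ge1Dx x); lra.
Qed.

(** The exponential weight pays a factor [l `^ (- a)] for a slightly stronger
    singularity, hence becomes small when [l] is large. *)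
Lemma integral_beta_exp (t d e a l : R) : 0 < t -> 0 < l -> 0 <= d -> 0 <= a ->
  d + a < 1 -> 0 <= e < 1 ->
  (\int[mu]_(x in `]0%R, t[) ((t - x) `^ (- d) * (x `^ (- e) * expR (l * x)))%:E <=
   (expR (l * t) * l `^ (- a) * (beta_bound (d + a) e * t `^ (1 - (d + a) - e)))%:E)%E.
Proof.
move=> t0 l0 d0 a0 da1 e01.
have mpow r (D : set R) : measurable_fun D (fun x : R => x `^ r).
  by apply: measurable_funTS; exact: measurable_powR.
have msub r := @measurable_powR_sub t r.
have mker r r' (D : set R) : measurable_fun D (fun x : R => (t - x) `^ r * x `^ r').
  exact: measurable_funM (msub r D) (mpow r' D).
have mexp (D : set R) : measurable_fun D (fun x : R => expR (l * x)).
  by apply: measurable_funTS; apply: measurableT_comp => //; exact: mulrl_measurable.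
have c0 : 0 <= expR (l * t) * l `^ (- a) by rewrite mulr_ge0 ?expR_ge0 ?powR_ge0.
apply: (@le_trans _ _ (\int[mu]_(x in `]0%R, t[) ((expR (l * t) * l `^ (- a))%:E *
    ((t - x) `^ (- (d + a)) * x `^ (- e))%:E))%E).
  apply: ge0_le_integral => //.
  - by move=> x _; rewrite lee_fin !mulr_ge0 ?powR_ge0 ?expR_ge0.
  - apply/measurable_EFinP; apply: measurable_funM; first exact: msub.
    by apply: measurable_funM; [exact: mpow|exact: mexp].
  - by apply: measurable_funeM; apply/measurable_EFinP; exact: mker.
  - move=> x; rewrite /= in_itv /= => /andP[x0 xt]; rewrite -EFinM lee_fin.
    have tx : 0 < t - x by rewrite subr_gt0.
    rewrite opprD powRD; last by apply/implyP => _; rewrite gt_eqF.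
    have -> : expR (l * t) * l `^ (- a) *
        ((t - x) `^ (- d) * (t - x) `^ (- a) * x `^ (- e)) =
      (t - x) `^ (- d) * (x `^ (- e) *
        (expR (l * t) * (l `^ (- a) * (t - x) `^ (- a)))) by ring.
    rewrite ler_wpM2l ?powR_ge0 // ler_wpM2l ?powR_ge0 //.
    rewrite -powRM ?(ltW l0) ?(ltW tx) // powRN ler_pdivlMr ?powR_gt0 ?mulr_gt0 //.
    have -> : l * t = l * x + l * (t - x) by ring.
    rewrite expRD ler_wpM2l ?expR_ge0 //; apply: powR_le_expR.
      by rewrite mulr_ge0 // ltW.
    by apply/andP; split => //; lra.
rewrite ge0_integralZl //; first last.
- by move=> x _; rewrite lee_fin mulr_ge0 ?powR_ge0.
- by apply/measurable_EFinP; exact: mker.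
rewrite [leRHS]EFinM; apply: lee_wpmul2l; first by rewrite lee_fin.
by apply: integral_beta => //; rewrite addr_ge0.
Qed.

End PowerIntegrals.

(** * Bounded operators and smoothing *)

Section BoundedOperatorTheory.
Context (R : realType) (E F : normedModType R).
Implicit Types A : E -> F.

Lemma linear_zero A : linear A -> A 0 = 0.
Proof.
move=> lA; have := lA 1 0 0; rewrite !scale1r !addr0 => A00.
by apply: (addrI (A 0)); rewrite addr0.
Qed.

Lemma linear_scale A a x : linear A -> A (a *: x) = a *: A x.
Proof. by move=> lA; rewrite -[a *: x]addr0 lA linear_zero // addr0. Qed.

Lemma linear_sub A x y : linear A -> A (x - y) = A x - A y.
Proof. by move=> lA; rewrite addrC -scaleN1r lA scaleN1r addrC. Qed.

Lemma opnorm_le A (C : R) : (forall x, `|A x| <= C * `|x|) -> 0 <= C ->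
  opnorm A <= C.
Proof.
move=> AC C0; apply: ge_sup.
  by exists `|A 0|; exists 0 => //=; rewrite normr0.
move=> _ [x /= x1 <-]; apply: le_trans (AC x) _.
by rewrite ler_piMr.
Qed.

Lemma bounded_operator_of_bound A (C : R) : linear A ->
  (forall x, `|A x| <= C * `|x|) -> bounded_operator A.
Proof.
move=> lA AC; split => //.
pose Al : {linear E -> F} := HB.pack A (GRing.isLinear.Build _ _ _ _ A lA).
apply/(linear_bounded_continuous Al)/linear_boundedP.
exists C; split; first exact: num_real.
move=> r Cr x; apply: le_trans (AC x) _.
by rewrite ler_wpM2r // ltW.
Qed.

Lemma bounded_operator_has_bound A : bounded_operator A ->
  exists2 C : R, 0 < C & forall x, `|A x| <= C * `|x|.
Proof.
move=> [lA cA].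
pose Al : {linear E -> F} := HB.pack A (GRing.isLinear.Build _ _ _ _ A lA).
have /linear_boundedP := (linear_bounded_continuous Al).2 cA.
move=> [C0 [_ C0b]]; exists (Num.max C0 0 + 1).
  by rewrite ltr_wpDl // le_max lexx orbT.
by apply: C0b; rewrite ltr_pwDr // le_max lexx.
Qed.

Lemma opnorm_ge A x : bounded_operator A -> `|A x| <= opnorm A * `|x|.
Proof.
move=> bA; have [lA _] := bA; have [C C0 AC] := bounded_operator_has_bound bA.
have [->|x0] := eqVneq x 0; first by rewrite linear_zero // !normr0 mulr0.
have nx0 : 0 < `|x| by rewrite normr_gt0.
rewrite -ler_pdivrMr //.
have -> : `|A x| / `|x| = `|A (`|x|^-1 *: x)|.
  by rewrite linear_scale // normrZ normfV normr_id mulrC.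
apply: ub_le_sup; last first.
  by exists (`|x|^-1 *: x) => //=; rewrite normrZ normfV normr_id mulVf ?gt_eqF.
exists C => _ [y /= y1 <-]; apply: le_trans (AC y) _.
by rewrite ler_piMr // ltW.
Qed.

Lemma opnorm_ge0 A : bounded_operator A -> 0 <= opnorm A.
Proof.
move=> bA; have [lA _] := bA; have [C C0 AC] := bounded_operator_has_bound bA.
apply: le_trans (normr_ge0 (A 0)) _; apply: ub_le_sup; last first.
  by exists 0 => //=; rewrite normr0.
exists C => _ [y /= y1 <-]; apply: le_trans (AC y) _.
by rewrite ler_piMr // ltW.
Qed.

End BoundedOperatorTheory.

Section Smoothing.
Context (R : realType) (X : banach_scale R).
Local Notation J := (scale_index X).
Implicit Types (F : op_family X) (g : J).

Lemma incl_val_in g v : range (incl g) v -> incl g (val_in g v) = v.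
Proof.
by move=> [x _ xv]; rewrite /val_in; apply: (@xgetPex _ 0 [set x | incl g x = v]);
  exists x.
Qed.

Lemma val_in_incl g (x : X g) : val_in g (incl g x) = x.
Proof. by apply: (@incl_inj _ X g); rewrite incl_val_in //; exists x. Qed.

Lemma smoothing_bounded_between F g g' t :
  smoothing F g g' -> 0 < t -> bounded_between F g g' t.
Proof.
move=> [_ [M [_ /(_ t)]]] FM t0.
by have [] := FM t0 t; rewrite ?t0 ?lexx.
Qed.

Lemma incl_op_between F g g' t (u : X g) : smoothing F g g' -> 0 < t ->
  incl g' (op_between F g' t u) = F g t u.
Proof.
by move=> sF t0; rewrite incl_val_in //; apply: (smoothing_bounded_between sF t0).1.
Qed.

Lemma op_between_linear F g g' t : smoothing F g g' -> 0 < t ->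
  linear (op_between F g' t : X g -> X g').
Proof. by move=> sF t0; exact: (smoothing_bounded_between sF t0).2.1. Qed.

Lemma smoothing_bound F g g' T : smoothing F g g' -> 0 < T ->
  exists2 M : R, 0 <= M & forall t (u : X g), 0 < t <= T ->
    `|op_between F g' t u| <= M * t `^ (- reg_diff g' g) * `|u|.
Proof.
move=> sF T0; have [_ [M [_ FM]]] := sF.
have FT t : 0 < t <= T -> opnorm (op_between F g' t : X g -> X g') <=
    M T * t `^ (- reg_diff g' g).
  by move=> tT; have [] := FM T T0 t tT.
exists (M T).
  rewrite -(@pmulr_lge0 _ (T `^ (- reg_diff g' g))) ?powR_gt0 //.
  apply: le_trans (FT T _); last by rewrite T0 lexx.
  by apply: opnorm_ge0; exact: (smoothing_bounded_between sF T0).2.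
move=> t u tT; have /andP[t0 _] := tT.
apply: le_trans (opnorm_ge _ (smoothing_bounded_between sF t0).2) _.
by rewrite ler_wpM2r // FT.
Qed.

Lemma smoothing_continuous_at F g g' (u : X g) t : smoothing_continuous F g g' ->
  0 < t -> {for t, continuous (fun s => op_between F g' s u : X g')}.
Proof.
move=> [_ cS] t0; have := cS u.
rewrite continuous_open_subspace; last exact: interval_open.
by move=> /(_ t) h; apply: h; rewrite inE /= in_itv /= t0.
Qed.

(** The best constant on [0 < t <= T] is automatically nondecreasing in [T], so
    it suffices to bound the operators on each bounded time interval. *)
Lemma smoothing_of_bound F g g' : 0 <= reg_diff g' g ->
  (forall t, 0 < t -> forall u : X g, range (incl g') (F g t u)) ->
  (forall t, 0 < t -> linear (op_between F g' t : X g -> X g')) ->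
  (forall T, 0 < T -> exists2 C : R, 0 <= C & forall t (u : X g), 0 < t <= T ->
    `|op_between F g' t u| <= C * t `^ (- reg_diff g' g) * `|u|) ->
  smoothing F g g'.
Proof.
move=> d0 rF lF bF; split => //; set d := reg_diff g' g in d0 bF *.
have bb t : 0 < t -> bounded_operator (op_between F g' t : X g -> X g').
  move=> t0; have [C C0 FC] := bF t t0.
  apply: (@bounded_operator_of_bound _ _ _ _ (C * t `^ (- d))); first exact: lF.
  by move=> x; apply: FC; rewrite t0 lexx.
pose A T := [set t `^ d * opnorm (op_between F g' t : X g -> X g') |
  t in [set t | 0 < t <= T]].
have ubA T : 0 < T -> has_ubound (A T).
  move=> T0; have [C C0 FC] := bF T T0; exists C => _ [t /= tT <-].
  have /andP[t0 _] := tT.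
  have : opnorm (op_between F g' t : X g -> X g') <= C * t `^ (- d).
    apply: opnorm_le; first by move=> x; exact: FC.
    by rewrite mulr_ge0 ?powR_ge0.
  by rewrite powRN ler_pdivlMr ?powR_gt0 // mulrC.
exists (fun T => sup (A T)); split=> [T1 T2 T10 T12|T T0 t tT].
  apply: sup_le; last 2 first.
  - by eexists; exists T1 => //=; rewrite T10 lexx.
  - by split; [eexists; exists T2; rewrite //= lexx (lt_le_trans T10)|
      apply: ubA; exact: lt_le_trans T12].
  move=> x [t /= /andP[t0 tT1] <-].
  apply/downP; eexists; last exact: lexx.
  by exists t => //=; rewrite t0 (le_trans tT1).
have /andP[t0 _] := tT; split; first by split; [exact: rF|exact: bb].
rewrite powRN ler_pdivlMr ?powR_gt0 // mulrC.
by apply: ub_le_sup; [exact: ubA|exists t].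
Qed.

End Smoothing.

(** * Duhamel integrals in the spaces of the scale *)

Section Grid.
Context (R : realType).

(** Rounding down moves times away from the singularity at the right end of
    the interval, so the values at grid points obey the same bounds. *)
Definition grid (k : nat) (x : R) : R := (Num.truncn (x * k.+1%:R))%:R / k.+1%:R.

Lemma grid_ge0 k x : 0 <= grid k x.
Proof. by rewrite divr_ge0. Qed.

Lemma grid_le k x : 0 <= x -> grid k x <= x.
Proof.
move=> x0; rewrite ler_pdivrMr //.
by have /andP[] := truncn_itv (mulr_ge0 x0 (ler0n R k.+1)).
Qed.

Lemma grid_cvg x : 0 <= x -> grid k x @[k --> \oo] --> x.
Proof.
move=> x0; apply/cvgrPdist_lt => e e0; near=> k.
rewrite ger0_norm ?subr_ge0 ?grid_le //.
have /andP[_] := truncn_itv (mulr_ge0 x0 (ler0n R k.+1)).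
rewrite -[(Num.truncn _).+1%:R]natr1 -ltr_pdivlMr // mulrDl mul1r => lek.
apply: (@lt_trans _ _ (k.+1%:R^-1)); first by rewrite ltrBlDl.
by near: k; exact: (near_infty_natSinv_lt (PosNum e0)).
Unshelve. all: by end_near. Qed.

Lemma finitely_valued_grid k (t : R) : finitely_valued
  (fun x : R => if `[< `]0, t[%classic x >] then grid k x else 0).
Proof.
pose q (x : R) := if `[< `]0, t[%classic x >]
  then Num.truncn (x * k.+1%:R) else 0%N.
rewrite (_ : (fun _ => _) = (fun n : nat => n%:R / k.+1%:R) \o q); last first.
  by apply/funext => x; rewrite /q /=; case: ifP => //; rewrite mul0r.
apply: finitely_valued_comp; split.
  apply: (@sub_finite_set _ _ (`I_(Num.truncn (t * k.+1%:R)).+1)) => //.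
  move=> _ [x _ <-]; rewrite /q /=; case: asboolP => //.
  rewrite /= in_itv /= => /andP[x0 xt]; rewrite ltnS le_truncn //.
  by rewrite ler_pM2r // ltW.
move=> j.
have mj : measurable (`[j%:R / k.+1%:R, j.+1%:R / k.+1%:R[%classic : set R).
  exact: measurable_itv.
rewrite (_ : q @^-1` [set j] =
  (`]0, t[ `&` `[j%:R / k.+1%:R, j.+1%:R / k.+1%:R[) `|`
  (~` `]0, t[ `&` [set x | 0%N = j])); last first.
  apply/seteqP; split => x /=; rewrite /q /=.
    case: asboolP => xt qx; [left|right]; split => //.
    move: xt; rewrite /= !in_itv /= => /andP[x0 xt].
    have := truncn_itv (mulr_ge0 (ltW x0) (ler0n R k.+1)).
    by rewrite qx ler_pdivrMr // ltr_pdivlMr.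
  case=> [[xt]|[xt <-]]; last by rewrite asboolF.
  rewrite asboolT // !in_itv /= ler_pdivrMr // ltr_pdivlMr // => jx.
  by apply/eqP; rewrite truncn_eq // mulr_ge0 //; move: xt; rewrite /= in_itv /= => /andP[/ltW].
apply: measurableU; apply: measurableI => //.
  exact: measurableC.
have [->|j0] := eqVneq 0%N j.
  by rewrite (_ : [set x | _] = setT) //; apply/seteqP; split.
by rewrite (_ : [set x | _] = set0) //; apply/seteqP; split => // x /= /eqP; rewrite (negbTE j0).
Qed.

End Grid.

Section ScaleIntegrals.
Context (R : realType) (X : banach_scale R).
Local Notation J := (scale_index X).
Local Notation mu := (@lebesgue_measure R).
Implicit Types (S : op_family X) (b g : J).

(** Both integrals are one and the same combination of the values of the pair
    [(s, s')]. *)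
Lemma incl_simple_integral (D : set R) g g' (s : R -> X g) (s' : R -> X g') :
  measurable D -> (mu D < +oo)%E -> simple_function s -> simple_function s' ->
  (forall x, incl g (s x) = incl g' (s' x)) ->
  incl g (simple_integral mu D s) = incl g' (simple_integral mu D s').
Proof.
move=> mD finD fs fs' ss'; pose q x := (s x, s' x).
have fvq : finitely_valued q by exact: finitely_valued_pair.
have [fq _] := fvq.
rewrite (@simple_integral_comp _ _ _ mu D mD finD _ _ fst q) //.
rewrite (@simple_integral_comp _ _ _ mu D mD finD _ _ snd q) //.
rewrite !fsbig_finite //= !linear_sum; apply: eq_big_seq => z.
rewrite in_fset_set // => /set_mem[x _ <-] /=.
by rewrite !linearZ /= ss'.
Qed.

(** The space [X g] occurs only as the place where the values are read: as
    ambient vectors the steps do not depend on it. *)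
Definition grid_step S b g (t : R) (v : nat -> R -> X b) (k : nat) (x : R) : X g :=
  if `[< `]0, t[%classic x >] then op_between S g (t - grid k x) (v k x) else 0.

Lemma simple_grid_step S b g t (v : nat -> R -> X b) k :
  simple_function (v k) -> simple_function (grid_step S g t v k).
Proof.
move=> fv.
have fvq := finitely_valued_pair
  (finitely_valued_asbool (measurable_itv `]0, t[))
  (finitely_valued_pair (finitely_valued_grid k t) fv).
have := finitely_valued_comp (fun z : bool * (R * X b) =>
  if z.1 then op_between S g (t - z.2.1) z.2.2 else 0 : X g) fvq.
rewrite (_ : _ \o _ = grid_step S g t v k) //.
by apply/funext => x; rewrite /grid_step /=; case: asboolP.
Qed.

(** The operators at the grid times are uniformly bounded, which takes care of
    the error in [w]; strong continuity takes care of the error in time. *)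
Lemma grid_step_cvg S b g t (v : nat -> R -> X b) (w : X b) x :
  smoothing_continuous S b g -> 0 < x < t -> v k x @[k --> \oo] --> w ->
  grid_step S g t v k x @[k --> \oo] --> op_between S g (t - x) w.
Proof.
move=> scS /andP[x0 xt] vw; have [sS _] := scS.
have t0 : 0 < t by exact: lt_trans xt.
have [M M0 SM] := smoothing_bound sS t0.
set d := reg_diff g b in SM.
have d0 : 0 <= d by case: sS.
have tgrid k : t - x <= t - grid k x <= t.
  by have := grid_le k (ltW x0); have := grid_ge0 k x; lra.
have tx0 : 0 < t - x by rewrite subr_gt0.
have tg0 k : 0 < t - grid k x by have /andP[h _] := tgrid k; exact: lt_le_trans h.
rewrite (_ : (fun k => grid_step S g t v k x) =
  (fun k => op_between S g (t - grid k x) (v k x - w) +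
            op_between S g (t - grid k x) w)); last first.
  apply/funext => k; rewrite /grid_step asboolT; last by rewrite /= in_itv /= x0.
  by rewrite (linear_sub _ _ (op_between_linear sS (tg0 k))) subrK.
rewrite -[X in _ --> X]add0r; apply: cvgD.
  apply/norm_cvg0P; apply: (@squeeze_cvgr _ _ _ _ (cst 0)
     (fun k => M * (t - x) `^ (- d) * `|v k x - w|)).
  - apply: nearW => k; rewrite normr_ge0 /=.
    apply: le_trans (SM (t - grid k x) _ _) _.
      by rewrite tg0 /=; case/andP: (tgrid k).
    rewrite ler_wpM2r // ler_wpM2l // !powRN lef_pV2 ?posrE ?powR_gt0 //.
    have /andP[tgk _] := tgrid k.
    by apply: ge0_ler_powR; rewrite ?nnegrE //; exact: ltW.
  - exact: cvg_cst.
  - rewrite -[X in _ --> X](mulr0 (M * (t - x) `^ (- d))).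
    apply: cvgMr; apply/norm_cvg0P.
    by rewrite -(subrr w); apply: cvgB => //; exact: cvg_cst.
have cSx := smoothing_continuous_at (u := w) scS tx0.
apply: (continuous_cvg _ cSx).
by apply: cvgB; [exact: cvg_cst|apply: grid_cvg; exact: ltW].
Qed.

End ScaleIntegrals.

Section Duhamel.
Context (R : realType) (X : banach_scale R).
Local Notation J := (scale_index X).
Local Notation mu := (@lebesgue_measure R).
Implicit Types (S : op_family X) (b g : J).

Lemma lebesgue_measure_itv_lty (a b : R) : (mu `]a, b[ < +oo)%E.
Proof. by rewrite lebesgue_measure_itv /=; case: ifP => // _; rewrite -EFinB ltry. Qed.

Lemma measurable_kernel (t r : R) (h : R -> R) (D : set R) : measurable_fun setT h ->
  measurable_fun D (fun x => ((t - x) `^ r * h x)%:E).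
Proof.
move=> mh; apply/measurable_EFinP; apply: measurable_funM.
  exact: measurable_powR_sub.
exact: measurable_funTS.
Qed.

(** Cutting at twice a majorant of the limit leaves room for convergence while
    providing the domination. *)
Definition truncated b (v : nat -> R -> X b) (h : R -> R) (k : nat) (x : R) : X b :=
  if `|v k x| <= h x then v k x else 0.

Lemma simple_truncated b (v : nat -> R -> X b) h k : simple_function (v k) ->
  measurable_fun setT h -> simple_function (truncated v h k).
Proof.
move=> fv mh.
have mB : measurable [set x | `|v k x| <= h x].
  have fvn : measurable_fun setT (fun x => `|v k x|).
    by apply: finitely_valued_measurable => //; exact: simple_function_norm.
  rewrite (_ : [set x | _] = [set: R] `&` (fun x => `|v k x| <= h x) @^-1` [set true]).
    exact: (measurable_fun_ler fvn mh).
  by rewrite setTI.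
have := finitely_valued_comp (fun z : bool * X b => if z.1 then z.2 else 0)
  (finitely_valued_pair (finitely_valued_asbool mB) fv).
rewrite (_ : _ \o _ = truncated v h k) //.
by apply/funext => x; rewrite /truncated /= asboolb.
Qed.

Lemma norm_truncated b (v : nat -> R -> X b) h k x : 0 <= h x ->
  `|truncated v h k x| <= h x.
Proof. by rewrite /truncated; case: ifP => //; rewrite normr0. Qed.

Lemma truncated_cvg b (v : nat -> R -> X b) (h : R -> R) x (w : X b) :
  `|w| <= h x -> v k x @[k --> \oo] --> w ->
  truncated v (fun x => 2 * h x) k x @[k --> \oo] --> w.
Proof.
move=> wh vw; have h0 : 0 <= h x by exact: le_trans wh.
(* Where the majorant vanishes there is no room, but all terms vanish too. *)
have [hx0|hx0] := eqVneq (h x) 0.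
  have -> : w = 0 by apply/eqP; rewrite -normr_le0 -hx0.
  rewrite (_ : (fun k => _) = cst 0); first exact: cvg_cst.
  apply/funext => k; rewrite /truncated hx0 mulr0 normr_le0.
  by case: eqP.
have hlt : `|w| < 2 * h x.
  have : 0 < h x by rewrite lt_neqAle eq_sym hx0.
  by move: wh; lra.
apply: (cvg_trans _ (vw)); apply: near_eq_cvg.
apply: filterS (cvgr_lt `|w| (cvg_norm vw) _ hlt) => k vk.
by rewrite /truncated ltW.
Qed.

Lemma duhamel_l1_integral S b g (t : R) (v : nat -> R -> X b) (w : R -> X b) N h :
  smoothing_continuous S b g -> 0 < t -> (forall k, simple_function (v k)) ->
  measurable N -> mu N = 0%E ->
  (forall x, 0 < x < t -> ~ N x -> v k x @[k --> \oo] --> w x) ->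
  (forall k x, 0 < x < t -> `|v k x| <= h x) ->
  mu.-integrable `]0, t[ (fun x => ((t - x) `^ (- reg_diff g b) * h x)%:E) ->
  exists2 I, l1_integral mu `]0, t[ (fun x => op_between S g (t - x) (w x)) I &
    simple_integral mu `]0, t[ (grid_step S g t v k) @[k --> \oo] --> I.
Proof.
move=> scS t0 fv mN N0 vw vh ih; have [sS _] := scS.
have d0 : 0 <= reg_diff g b by case: sS.
have [M M0 SM] := smoothing_bound sS t0.
apply: (@l1_integral_dominated _ _ _ _ _ _ _ _ N _ _
  (fun x => M * ((t - x) `^ (- reg_diff g b) * h x))) => //.
- exact: lebesgue_measure_itv_lty.
- by move=> k; exact: simple_grid_step.
- move=> x; rewrite /= in_itv /= => xt Nx; apply: grid_step_cvg => //.
  exact: vw.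
- rewrite (_ : EFin \o _ = (fun x => M%:E * ((t - x) `^ (- reg_diff g b) * h x)%:E)%E).
    by apply: integrableZl => //; exact: measurable_itv.
  by apply/funext => x /=; rewrite EFinM.
- move=> k x xD _; rewrite /grid_step asboolT //.
  move: xD; rewrite /= in_itv /= => xt; have /andP[x0 x1] := xt.
  have g0 := grid_ge0 k x; have gx := grid_le k (ltW x0).
  apply: le_trans (SM (t - grid k x) _ _) _; first by apply/andP; split; lra.
  rewrite -mulrA ler_wpM2l // ler_pM ?powR_ge0 ?vh //.
  rewrite !powRN lef_pV2 ?posrE ?powR_gt0 //; [|lra|lra].
  by apply: ge0_ler_powR; rewrite ?nnegrE //; lra.
Qed.

(** The same simple functions approximate the integrand in both spaces, so that
    the topological consistency of the scale identifies the two integrals. *)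
Lemma duhamel_consistent S b g g' (t : R) (w : R -> X b) h :
  smoothing_continuous S b g -> smoothing_continuous S b g' -> 0 < t ->
  strongly_measurable mu `]0, +oo[ w -> measurable_fun setT h ->
  (forall x, 0 < x < t -> `|w x| <= h x) ->
  mu.-integrable `]0, t[ (fun x => ((t - x) `^ (- reg_diff g b) * h x)%:E) ->
  mu.-integrable `]0, t[ (fun x => ((t - x) `^ (- reg_diff g' b) * h x)%:E) ->
  exists I I',
  [/\ l1_integral mu `]0, t[ (fun x => op_between S g (t - x) (w x)) I,
      l1_integral mu `]0, t[ (fun x => op_between S g' (t - x) (w x)) I'
    & incl g I = incl g' I'].
Proof.
move=> scS scS' t0 [v [fv [N [mN N0 vN]]]] mh wh ih ih'.
have vw x : 0 < x < t -> ~ N x -> v k x @[k --> \oo] --> w x.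
  move=> /andP[x0 _]; apply: contra_notP => nconv; apply: vN => /=.
  by rewrite in_itv /= x0 => /(_ isT).
pose v' := truncated v (fun x => 2 * h x).
have mh2 : measurable_fun setT (fun x => 2 * h x) by exact: measurable_funM.
have fv' k : simple_function (v' k) by exact: (simple_truncated (fv k) mh2).
have v'w x : 0 < x < t -> ~ N x -> v' k x @[k --> \oo] --> w x.
  by move=> xt Nx; apply: truncated_cvg; [exact: wh|exact: vw].
have v'h k x : 0 < x < t -> `|v' k x| <= 2 * h x.
  by move=> xt; apply: norm_truncated; rewrite mulr_ge0 // (le_trans _ (wh x xt)).
have ih2 r : mu.-integrable `]0, t[ (fun x => ((t - x) `^ r * h x)%:E) ->
    mu.-integrable `]0, t[ (fun x => ((t - x) `^ r * (2 * h x))%:E).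
  move=> ir; rewrite (_ : (fun _ => _) = (fun x => 2%:E * ((t - x) `^ r * h x)%:E)%E).
    by apply: integrableZl => //; exact: measurable_itv.
  by apply/funext => x; rewrite -EFinM mulrCA.
have [I fI vI] := duhamel_l1_integral scS t0 fv' mN N0 v'w v'h (ih2 _ ih).
have [I' fI' vI'] := duhamel_l1_integral scS' t0 fv' mN N0 v'w v'h (ih2 _ ih').
exists I, I'; split => //.
apply: (topologically_consistent _ vI vI') => k.
apply: incl_simple_integral; [exact: measurable_itv|exact: lebesgue_measure_itv_lty
  |exact: simple_grid_step|exact: simple_grid_step|].
move=> x; rewrite /grid_step; case: asboolP; last by rewrite !linear0.
rewrite /= in_itv /= => /andP[x0 xt].
have tg : 0 < t - grid k x by have := grid_le k (ltW x0); lra.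
have [sS _] := scS; have [sS' _] := scS'.
by rewrite (incl_op_between _ sS tg) (incl_op_between _ sS' tg).
Qed.

Lemma duhamel_norm S b g (t M : R) (w : R -> X b) (h : R -> R) I :
  0 <= M ->
  (forall s (u : X b), 0 < s <= t ->
     `|op_between S g s u| <= M * s `^ (- reg_diff g b) * `|u|) ->
  l1_integral mu `]0, t[ (fun x => op_between S g (t - x) (w x)) I ->
  measurable_fun setT h -> (forall x, 0 < x < t -> `|w x| <= h x) ->
  (`|I|%:E <= M%:E *
     \int[mu]_(x in `]0%R, t[) ((t - x) `^ (- reg_diff g b) * h x)%:E)%E.
Proof.
move=> M0 SM fI mh wh.
have mk := @measurable_kernel t (- reg_diff g b) h `]0, t[ mh.
have h0 x : 0 < x < t -> 0 <= h x by move=> xt; exact: le_trans (wh x xt).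
rewrite -ge0_integralZl //; last first.
  by move=> x; rewrite /= in_itv /= => /h0 hx; rewrite lee_fin mulr_ge0 ?powR_ge0.
apply: (l1_integral_norm _ _ fI).
- exact: measurable_itv.
- exact: lebesgue_measure_itv_lty.
- exact: measurable_funeM.
move=> x; rewrite /= in_itv /= => xt; rewrite -EFinM lee_fin.
have /andP[x0 x1] := xt.
apply: le_trans (SM (t - x) (w x) _) _; first by apply/andP; split; lra.
by rewrite -mulrA ler_wpM2l // ler_wpM2l ?powR_ge0 // wh.
Qed.

End Duhamel.

Section KernelEstimates.
Context (R : realType) (X : banach_scale R).
Local Notation mu := (@lebesgue_measure R).
Implicit Types (S : op_family X) (b g : scale_index X).

Lemma measurable_power_exp (e l : R) :
  measurable_fun setT (fun x : R => x `^ (- e) * expR (l * x)).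
Proof.
apply: measurable_funM; first exact: measurable_powR.
by apply: measurableT_comp => //; exact: mulrl_measurable.
Qed.

Lemma integrable_kernel (t d e C : R) : 0 < t -> 0 <= d < 1 -> 0 <= e < 1 -> 0 <= C ->
  mu.-integrable `]0, t[ (fun x => ((t - x) `^ (- d) * (C * x `^ (- e)))%:E).
Proof.
move=> t0 d01 e01 C0.
rewrite (_ : (fun _ => _) = (fun x => C%:E * ((t - x) `^ (- d) * x `^ (- e))%:E)%E); last first.
  by apply/funext => x; rewrite -EFinM mulrCA.
apply: integrableZl => //.
apply/integrableP; split.
  by apply: measurable_kernel; exact: measurable_powR.
apply: le_lt_trans (_ : _ <= (beta_bound d e * t `^ (1 - d - e))%:E)%E (ltry _).
apply: le_trans (integral_beta t0 d01 e01).
rewrite le_eqVlt; apply/orP; left; apply/eqP; apply: eq_integral => x _.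
by rewrite abse_EFin ger0_norm // mulr_ge0 ?powR_ge0.
Qed.

Lemma duhamel_norm_pow S b g (t M e C : R) (w : R -> X b) I :
  0 < t -> 0 <= reg_diff g b < 1 -> 0 <= e < 1 -> 0 <= M -> 0 <= C ->
  (forall s (u : X b), 0 < s <= t ->
     `|op_between S g s u| <= M * s `^ (- reg_diff g b) * `|u|) ->
  l1_integral mu `]0, t[ (fun x => op_between S g (t - x) (w x)) I ->
  (forall x, 0 < x < t -> `|w x| <= C * x `^ (- e)) ->
  `|I| <= M * (C * (beta_bound (reg_diff g b) e * t `^ (1 - reg_diff g b - e))).
Proof.
move=> t0 d01 e01 M0 C0 SM fI wC.
have mh : measurable_fun setT (fun x : R => C * x `^ (- e)).
  by apply: measurable_funM => //; exact: measurable_powR.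
rewrite -lee_fin; apply: le_trans (duhamel_norm M0 SM fI mh wC) _.
rewrite EFinM; apply: lee_wpmul2l; first by rewrite lee_fin.
rewrite EFinM; apply: le_trans (lee_wpmul2l _ (integral_beta t0 d01 e01)); last first.
  by rewrite lee_fin.
rewrite -ge0_integralZl //; last 2 first.
- by apply: measurable_kernel; exact: measurable_powR.
- by move=> x _; rewrite lee_fin mulr_ge0 ?powR_ge0.
rewrite le_eqVlt; apply/orP; left; apply/eqP; apply: eq_integral => x _.
by rewrite -EFinM mulrCA.
Qed.

Lemma duhamel_norm_exp S b g (t M e a l C : R) (w : R -> X b) I :
  0 < t -> 0 <= reg_diff g b -> 0 <= a -> reg_diff g b + a < 1 -> 0 < l ->
  0 <= e < 1 -> 0 <= M -> 0 <= C ->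
  (forall s (u : X b), 0 < s <= t ->
     `|op_between S g s u| <= M * s `^ (- reg_diff g b) * `|u|) ->
  l1_integral mu `]0, t[ (fun x => op_between S g (t - x) (w x)) I ->
  (forall x, 0 < x < t -> `|w x| <= C * (x `^ (- e) * expR (l * x))) ->
  `|I| <= M * (C * (expR (l * t) * l `^ (- a) *
    (beta_bound (reg_diff g b + a) e * t `^ (1 - (reg_diff g b + a) - e)))).
Proof.
move=> t0 d0 a0 da1 l0 e01 M0 C0 SM fI wC.
have mh : measurable_fun setT (fun x : R => C * (x `^ (- e) * expR (l * x))).
  by apply: measurable_funM => //; exact: measurable_power_exp.
rewrite -lee_fin; apply: le_trans (duhamel_norm M0 SM fI mh wC) _.
rewrite EFinM; apply: lee_wpmul2l; first by rewrite lee_fin.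
rewrite EFinM.
apply: le_trans (lee_wpmul2l _ (integral_beta_exp t0 l0 d0 a0 da1 e01)); last first.
  by rewrite lee_fin.
rewrite -ge0_integralZl //; last 2 first.
- by apply: measurable_kernel; exact: measurable_power_exp.
- by move=> x _; rewrite lee_fin !mulr_ge0 ?powR_ge0 ?expR_ge0.
rewrite le_eqVlt; apply/orP; left; apply/eqP; apply: eq_integral => x _.
by rewrite -EFinM mulrCA.
Qed.

(** Each term is small beyond its own threshold [m i]; the sum of the thresholds
    exceeds all of them. *)
Lemma exists_small_weight n (c a : 'I_n -> R) :
  (forall i, 0 <= c i) -> (forall i, 0 < a i) ->
  exists2 l, 0 < l & \sum_(i < n) c i * l `^ (- a i) <= 2^-1.
Proof.
move=> c0 a0; pose m i := (2 * n.+1%:R * c i) `^ (a i)^-1.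
exists (1 + \sum_(i < n) m i).
  by rewrite ltr_wpDr // sumr_ge0 // => i _; exact: powR_ge0.
set l := 1 + _.
have ml i : m i <= l.
  rewrite /l (bigD1 i) //= addrCA lerDl addr_ge0 // sumr_ge0 // => j _.
  exact: powR_ge0.
have l0 : 0 < l.
  by rewrite ltr_wpDr // sumr_ge0 // => i _; exact: powR_ge0.
apply: (@le_trans _ _ (\sum_(i < n) (2 * n.+1%:R)^-1)).
  apply: ler_sum => i _; rewrite powRN ler_pdivrMr ?powR_gt0 //.
  rewrite ler_pdivlMl ?mulr_gt0 //.
  have c2 : 0 <= 2 * n.+1%:R * c i by rewrite !mulr_ge0.
  have -> : 2 * n.+1%:R * c i = m i `^ a i.
    by rewrite /m -powRrM mulVf ?gt_eqF // powRr1.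
  by apply: ge0_ler_powR; rewrite ?nnegrE ?powR_ge0 ?ml //; exact: ltW.
rewrite sumr_const card_ord -[_ *+ n]mulr_natl invfM mulrCA ler_piMr //.
by rewrite ler_pdivrMr // mul1r ler_nat.
Qed.

End KernelEstimates.

(** * The integral equation: a priori bound and uniqueness *)

Section MildSolutions.
Context (R : realType) (X : banach_scale R).
Local Notation mu := (@lebesgue_measure R).
Variables (S : op_family X) (alpha : scale_index X) (n : nat).
Variables (beta : 'I_n -> scale_index X) (rho : R).
Variable P : forall i : 'I_n, X alpha -> X (beta i).
Hypothesis rho_ge0 : 0 <= rho.
Hypothesis hP : forall i : 'I_n, perturbation_class S rho (P i).

Lemma perturbation_norm i x : `|P i x| <= rho * `|x|.
Proof.
have [_ _ bP oP] := hP i.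
by apply: le_trans (opnorm_ge x bP) _; rewrite ler_wpM2r.
Qed.

Section Datum.
Variable gamma : scale_index X.
Hypothesis hgamma : scrE S alpha gamma.
Local Notation e := (reg_diff alpha gamma).

(** Only the growth at [0] and the formula are retained: both are stable under
    linear combinations, which is all that uniqueness needs. *)
Definition mild_solution (u0 : X gamma) (u : R -> X alpha) :=
  (forall T, 0 < T -> exists K, forall t, 0 < t <= T -> t `^ e * `|u t| <= K) /\
  (forall t, 0 < t -> exists I : 'I_n -> X alpha,
    (forall i, l1_integral mu `]0, t[
       (fun x => op_between S alpha (t - x) (P i (u x))) (I i)) /\
    u t = op_between S alpha t u0 + \sum_(i < n) I i).

Lemma scrE_exponent : 0 <= e < 1.
Proof.
have [] := hgamma; rewrite in_itv /= /reg_diff => /andP[g1 g2] _.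
by apply/andP; split; lra.
Qed.

Lemma Linfty_mild_solution u0 u : Linfty_loc e u -> solves_vcf S P u0 u ->
  mild_solution u0 u.
Proof.
move=> [_ bu] su; split.
  move=> T T0; have [K uK] := bu T T0; exists K => t tT; apply: uK.
  by exists t => //=; rewrite in_itv.
move=> t t0; have [I [fI uI]] := su t t0; exists I; split => // i.
by apply: (is_bochner_l1_integral _ (fI i)); exact: measurable_itv.
Qed.

Lemma mild_solution_linear a u0 v0 u v :
  mild_solution u0 u -> mild_solution v0 v ->
  mild_solution (a *: u0 + v0) (fun t => a *: u t + v t).
Proof.
move=> [bu su] [bv sv]; split.
  move=> T T0; have [K uK] := bu T T0; have [L vL] := bv T T0.
  exists (`|a| * K + L) => t tT; apply: (@le_trans _ _
    (`|a| * (t `^ e * `|u t|) + t `^ e * `|v t|)).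
    rewrite mulrCA -mulrDr ler_wpM2l ?powR_ge0 // -normrZ; exact: ler_normD.
  by rewrite lerD ?vL // ler_wpM2l // uK.
move=> t t0; have [I [fI uI]] := su t t0; have [I' [fI' vI']] := sv t t0.
exists (fun i => a *: I i + I' i); split.
  move=> i; have [_ [sS _] [lP _] _] := hP i.
  apply: l1_integral_ext (l1_integral_linear _ _ a (fI i) (fI' i)).
  - move=> x; rewrite /= in_itv /= => /andP[x0 xt].
    by rewrite lP (op_between_linear sS) // subr_gt0.
  - exact: measurable_itv.
  - exact: lebesgue_measure_itv_lty.
have [_ [sS _]] := hgamma.
rewrite uI vI' (op_between_linear sS t0) big_split -scaler_sumr scalerDr.
by rewrite addrACA.
Qed.

(** In the norm [sup t ^ e * exp (- l * t) * |u t|] the perturbation terms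
    contract as soon as [l] is large. *)
Lemma mild_solution_bound T : 0 < T ->
  exists2 C, 0 <= C & forall u0 u, mild_solution u0 u ->
    forall t, 0 < t <= T -> `|u t| <= C * `|u0| * t `^ (- e).
Proof.
move=> T0; have [_ [sS _]] := hgamma; have /andP[e0 e1] := scrE_exponent.
have [M0 M00 SM0] := smoothing_bound sS T0.
have /fin_all_exists2[M Mge0 SM] : forall i : 'I_n, exists2 M : R, 0 <= M &
    forall t (u : X (beta i)), 0 < t <= T ->
    `|op_between S alpha t u| <= M * t `^ (- reg_diff alpha (beta i)) * `|u|.
  by move=> i; have [_ [sSi _] _ _] := hP i; exact: smoothing_bound.
pose d i := reg_diff alpha (beta i).
have d01 i : 0 <= d i < 1 by have [] := hP i.
(* Half of the margin [1 - d i] of integrability is spent on the decay in [l]. *)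
pose a i := (1 - d i) / 2.
have a0 i : 0 < a i by have /andP[_ di1] := d01 i; rewrite /a; lra.
have da1 i : d i + a i < 1 by have /andP[_ di1] := d01 i; rewrite /a; lra.
have da0 i : 0 <= d i + a i by have /andP[di0 _] := d01 i; have := a0 i; lra.
pose B i := beta_bound (d i + a i) e.
have B0 i : 0 <= B i by exact: beta_bound_ge0.
pose c i := M i * rho * B i * T `^ (1 - (d i + a i)).
have c0 i : 0 <= c i by rewrite !mulr_ge0 // powR_ge0.
have [l l0 lc] := exists_small_weight c0 a0.
exists (2 * M0 * expR (l * T)); first by rewrite !mulr_ge0 ?expR_ge0.
move=> u0 u [bu su].
pose N t := t `^ e * expR (- (l * t)) * `|u t|.
pose A := [set N t | t in [set t | 0 < t <= T]].
have N0 t : 0 <= N t by rewrite !mulr_ge0 ?powR_ge0 ?expR_ge0.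
have ubA : has_ubound A.
  have [K uK] := bu T T0; exists K => _ [t /= tT <-].
  apply: le_trans (uK t tT); rewrite /N mulrAC ler_piMr ?mulr_ge0 ?powR_ge0 //.
  by rewrite -expR0 ler_expR oppr_le0 mulr_ge0 // ltW //; case/andP: tT.
pose K := sup A.
have NK t : 0 < t <= T -> N t <= K by move=> tT; apply: ub_le_sup => //; exists t.
have K0 : 0 <= K by apply: le_trans (NK T _) => //; rewrite T0 lexx.
have uNE t : 0 < t -> `|u t| = N t * (t `^ (- e) * expR (l * t)).
  move=> t0; rewrite /N powRN expRN.
  have te : t `^ e != 0 by rewrite gt_eqF ?powR_gt0.
  have el : expR (l * t) != 0 by rewrite gt_eqF ?expR_gt0.
  by field; rewrite te el.
have uK t : 0 < t <= T -> `|u t| <= K * (t `^ (- e) * expR (l * t)).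
  move=> tT; rewrite uNE; last by case/andP: tT.
  by rewrite ler_wpM2r ?NK // mulr_ge0 ?powR_ge0 ?expR_ge0.
have NM t : 0 < t <= T -> N t <= M0 * `|u0| + K / 2.
  move=> tT; have /andP[t0 tT'] := tT.
  have [I [fI uI]] := su t t0.
  have te : t `^ e * t `^ (- e) = 1 by rewrite powRN divff // gt_eqF ?powR_gt0.
  have el : expR (- (l * t)) * expR (l * t) = 1 by rewrite -expRD addNr expR0.
  pose W := t `^ e * expR (- (l * t)).
  have W0 : 0 <= W by rewrite mulr_ge0 ?powR_ge0 ?expR_ge0.
  have free : W * `|op_between S alpha t u0| <= M0 * `|u0|.
    apply: le_trans (ler_wpM2l W0 (SM0 t u0 tT)) _.
    have -> : W * (M0 * t `^ (- e) * `|u0|) =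
      expR (- (l * t)) * (M0 * `|u0|) * (t `^ e * t `^ (- e)) by rewrite /W; ring.
    rewrite te mulr1 ler_piMl ?mulr_ge0 //.
    by rewrite -expR0 ler_expR oppr_le0 mulr_ge0 // ltW.
  have pert i : W * `|I i| <= K * (c i * l `^ (- a i)).
    have Pu x : 0 < x < t ->
        `|P i (u x)| <= rho * K * (x `^ (- e) * expR (l * x)).
      move=> /andP[x0 xt]; apply: le_trans (perturbation_norm i _) _.
      by rewrite -mulrA ler_wpM2l // uK // x0 (le_trans (ltW xt)).
    have di0 : 0 <= d i by have /andP[] := d01 i.
    have SMt s (x : X (beta i)) : 0 < s <= t ->
        `|op_between S alpha s x| <= M i * s `^ (- d i) * `|x|.
      by move=> /andP[s0 st]; apply: SM; rewrite s0 (le_trans st).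
    have := duhamel_norm_exp t0 di0 (ltW (a0 i)) (da1 i) l0 scrE_exponent
      (Mge0 i) (mulr_ge0 rho_ge0 K0) SMt (fI i) Pu.
    move=> /(ler_wpM2l W0)/le_trans; apply.
    have -> : t `^ (1 - (d i + a i) - e) = t `^ (1 - (d i + a i)) * t `^ (- e).
      by rewrite powRD //; apply/implyP => _; rewrite gt_eqF.
    rewrite [leLHS](_ : _ = K * (M i * rho * B i * t `^ (1 - (d i + a i)) * l `^ (- a i))
      * (t `^ e * t `^ (- e)) * (expR (- (l * t)) * expR (l * t))); last first.
      by rewrite /W /B /d; ring.
    rewrite te el !mulr1 ler_wpM2l // ler_wpM2r ?powR_ge0 //.
    rewrite /c ler_wpM2l ?mulr_ge0 //.
    by apply: ge0_ler_powR; rewrite ?nnegrE ?subr_ge0 // ltW.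
  rewrite /N -/W uI; apply: le_trans (ler_wpM2l W0 (ler_normD _ _)) _.
  rewrite mulrDr lerD //.
  apply: le_trans (ler_wpM2l W0 (ler_norm_sum _ _ _)) _.
  rewrite mulr_sumr; apply: le_trans (ler_sum _ (fun i _ => pert i)) _.
  by rewrite -mulr_sumr ler_wpM2l.
have KM : K <= 2 * M0 * `|u0|.
  have : K <= M0 * `|u0| + K / 2.
    apply: ge_sup; first by exists (N T), T => //=; rewrite T0 lexx.
    by move=> _ [t tT <-]; exact: NM.
  lra.
move=> t tT; have /andP[t0 tT'] := tT.
apply: le_trans (uK t tT) _.
apply: le_trans (ler_wpM2r _ KM) _; first by rewrite mulr_ge0 ?powR_ge0 ?expR_ge0.
rewrite (_ : 2 * M0 * expR (l * T) * `|u0| * t `^ (- e) =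
  2 * M0 * `|u0| * (t `^ (- e) * expR (l * T))); last by ring.
rewrite ler_wpM2l ?mulr_ge0 // ler_wpM2l ?powR_ge0 // ler_expR ler_wpM2l //.
exact: ltW.
Qed.

(** The difference solves the equation with datum [0], where the bound is [0]. *)
Lemma mild_solution_unique u0 u v : mild_solution u0 u -> mild_solution u0 v ->
  forall t, 0 < t -> u t = v t.
Proof.
move=> su sv t t0; have [C C0 Cb] := mild_solution_bound t0.
have := Cb _ _ (mild_solution_linear (-1) su sv) t.
rewrite t0 lexx => /(_ isT).
rewrite !scaleN1r [- u0 + _]addrC subrr normr0 mulr0 mul0r normr_le0 addrC subr_eq0.
by move/eqP.
Qed.

End Datum.
End MildSolutions.

(** * Continuity in time of Duhamel integrals *)

Section DuhamelContinuity.
Context (R : realType) (X : banach_scale R).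
Local Notation mu := (@lebesgue_measure R).
Implicit Types (S : op_family X) (b g : scale_index X).

Lemma exists_powR_small (K d s1 eps : R) : d < 1 -> 0 < s1 -> 0 < eps ->
  exists2 s, 0 < s < s1 & K * s `^ (1 - d) < eps.
Proof.
move=> d1 s10 eps0.
have cvgK : K * s `^ (1 - d) @[s --> 0^'+] --> K * 0.
  by apply: cvgMr; apply: powR_cvg0; rewrite subr_gt0.
rewrite mulr0 in cvgK.
have lteps := cvgr_lt _ cvgK _ eps0.
near (0 : R)^'+ => s.
exists s; last first.
  by near: s; exact: lteps.
apply/andP; split; near: s; first exact: nbhs_right_gt.
exact: nbhs_right_lt.
Unshelve. all: by end_near. Qed.

Section Cut.
Variables (S : op_family X) (b g : scale_index X) (e : R).
Hypotheses (scS : smoothing_continuous S b g) (d01 : 0 <= reg_diff g b < 1)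
  (e01 : 0 <= e < 1).
Local Notation d := (reg_diff g b).
Variables (v : nat -> R -> X b) (w : R -> X b) (J : R -> X g).
Variables (B C M : R).
Hypotheses (fv : forall k, simple_function (v k))
  (vw : forall x, 0 < x -> v k x @[k --> \oo] --> w x)
  (C0 : 0 <= C) (M0 : 0 <= M)
  (wC : forall x, 0 < x < B -> `|w x| <= C * x `^ (- e))
  (SM : forall s (u : X b), 0 < s <= B ->
     `|op_between S g s u| <= M * s `^ (- d) * `|u|)
  (fJ : forall t, 0 < t -> l1_integral mu `]0, t[
    (fun x => op_between S g (t - x) (w x)) (J t)).

Let sS : smoothing S b g. Proof. by case: scS. Qed.

Let wcut c x := if x < c then w x else 0.

Lemma head_integral_exists c t : 0 < c -> c < t < B -> exists A,
  l1_integral mu `]0, t[ (fun x => op_between S g (t - x) (wcut c x)) A.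
Proof.
move=> c0 /andP[ct tB]; have t0 : 0 < t by exact: lt_trans ct.
pose h x := C * x `^ (- e).
have mh : measurable_fun setT h.
  by apply: measurable_funM => //; exact: measurable_powR.
have mh2 : measurable_fun setT (fun x => 2 * h x) by exact: measurable_funM.
have mc : measurable [set x : R | x < c].
  rewrite (_ : [set x | _] = `]-oo, c[%classic); first exact: measurable_itv.
  by apply/seteqP; split => x /=; rewrite in_itv.
pose v' k x := if x < c then truncated v (fun x => 2 * h x) k x else 0.
have fv' k : simple_function (v' k).
  have := finitely_valued_comp (fun z : bool * X b => if z.1 then z.2 else 0)
    (finitely_valued_pair (finitely_valued_asbool mc)
      (simple_truncated (fv k) mh2)).
  rewrite (_ : _ \o _ = v' k) //.
  by apply/funext => x; rewrite /v' /= asboolb.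
have h0 x : 0 <= h x by rewrite mulr_ge0 ?powR_ge0.
have [|||A fA _] := @duhamel_l1_integral _ _ S b g t v' (wcut c) set0
  (fun x => 2 * h x) scS t0 fv' measurable0 (measure0 _).
- move=> x /andP[x0 xt] _; rewrite /v' /wcut; case: ifP => _; last exact: cvg_cst.
  by apply: truncated_cvg; [apply: wC; rewrite x0 (lt_trans xt)|exact: vw].
- move=> k x _; rewrite /v'; case: ifP => _; last by rewrite normr0 mulr_ge0.
  by apply: (@norm_truncated _ _ _ _ (fun x => 2 * h x)); rewrite mulr_ge0.
- rewrite (_ : (fun _ => _) = (fun x => ((t - x) `^ (- d) * (2 * C * x `^ (- e)))%:E)).
    by apply: integrable_kernel => //; rewrite mulr_ge0.
  by apply/funext => x; rewrite /h -[2 * C * _]mulrA.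
by exists A.
Qed.

Lemma tail_integral_norm c t A : 0 < c -> c < t < B ->
  l1_integral mu `]0, t[ (fun x => op_between S g (t - x) (wcut c x)) A ->
  `|J t - A| <= M * (C * c `^ (- e)) * ((t - c) `^ (1 - d) / (1 - d)).
Proof.
move=> c0 /andP[ct tB] fA; have t0 : 0 < t by exact: lt_trans ct.
have /andP[e0 e1] := e01; have /andP[d0 d1] := d01.
pose H := C * c `^ (- e).
have H0 : 0 <= H by rewrite mulr_ge0 ?powR_ge0.
pose h x := if c <= x then H else 0.
have mc : measurable [set x : R | c <= x].
  rewrite (_ : [set x | _] = `[c, +oo[%classic); first exact: measurable_itv.
  by apply/seteqP; split => x /=; rewrite in_itv /= andbT.
have fh : finitely_valued h.
  have := finitely_valued_comp (fun z : bool => if z then H else 0)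
    (finitely_valued_asbool mc).
  by rewrite (_ : _ \o _ = h) //; apply/funext => x; rewrite /h /= asboolb.
have mh : measurable_fun setT h by exact: finitely_valued_measurable.
have wtail x : 0 < x < t -> `|-1 *: wcut c x + w x| <= h x.
  move=> /andP[x0 xt]; rewrite /wcut /h (leNgt c x); case: ifP => xc /=.
    by rewrite scaleN1r addNr normr0.
  rewrite scaler0 add0r; apply: le_trans (wC _) _; first by rewrite x0 (lt_trans xt).
  rewrite ler_wpM2l // !powRN lef_pV2 ?posrE ?powR_gt0 //.
  have cx : c <= x by rewrite leNgt xc.
  by apply: ge0_ler_powR; rewrite ?nnegrE //; exact: ltW.
have f2 : l1_integral mu `]0, t[
    (fun x => op_between S g (t - x) (-1 *: wcut c x + w x)) (-1 *: A + J t).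
  apply: l1_integral_ext (l1_integral_linear _ _ (-1) fA (fJ t0)).
  - move=> x; rewrite /= in_itv /= => /andP[x0 xt].
    by rewrite (op_between_linear sS) // subr_gt0.
  - exact: measurable_itv.
  - exact: lebesgue_measure_itv_lty.
have SMt s (u : X b) : 0 < s <= t -> `|op_between S g s u| <= M * s `^ (- d) * `|u|.
  by move=> /andP[s0 st]; apply: SM; rewrite s0 (le_trans st) // ltW.
rewrite addrC -scaleN1r -lee_fin.
apply: le_trans (duhamel_norm M0 SMt f2 mh wtail) _.
rewrite -[leRHS]/((M * H * _)%:E) -mulrA EFinM; apply: lee_wpmul2l.
  by rewrite lee_fin.
rewrite EFinM.
apply: (@le_trans _ _ (H%:E * \int[mu]_(x in `]c, t[) ((t - x) `^ (- d))%:E)%E); last first.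
  by apply: lee_wpmul2l; [rewrite lee_fin|exact: integral_powR_tail].
have mp (D : set R) : measurable_fun D (fun x : R => ((t - x) `^ (- d))%:E).
  by apply/measurable_EFinP; exact: measurable_powR_sub.
rewrite -ge0_integralZl //; [|exact: mp|by move=> x _; rewrite lee_fin powR_ge0].
have itvE : (\int[mu]_(x in `]c, t[) (H%:E * ((t - x) `^ (- d))%:E) =
    \int[mu]_(x in `[c, t[) (H%:E * ((t - x) `^ (- d))%:E))%E.
  by apply: integral_itv_obnd_cbnd; exact: measurable_funeM (mp _).
rewrite itvE.
rewrite le_eqVlt; apply/orP; left; apply/eqP.
rewrite integral_mkcond [RHS]integral_mkcond; apply: eq_integral => x _.
rewrite !patchE !mem_setE !in_itv /= /h.
have [cx|cx] := leP c x; last by rewrite mulr0 if_same.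
by rewrite (lt_le_trans c0 cx) /=; case: ifP => //; rewrite mulrC EFinM.
Qed.

Let kernel_gap t0 t x : R :=
  `|op_between S g (t - x) (w x) - op_between S g (t0 - x) (w x)|.

Lemma measurable_kernel_gap (c t0 t : R) : c < t0 -> c < t ->
  measurable_fun `]0, c[ (kernel_gap t0 t).
Proof.
move=> ct0 ct; apply: (@measurable_fun_cvg _ _ _ _
  (fun k x => `|grid_step S g t v k x - grid_step S g t0 v k x|)).
  move=> k; apply: finitely_valued_measurable; first exact: measurable_itv.
  exact: (finitely_valued_comp (fun z => `|z.1 - z.2|)
    (finitely_valued_pair (simple_grid_step S g t (fv k))
      (simple_grid_step S g t0 (fv k)))).
move=> x; rewrite /= in_itv /= => /andP[x0 xc].
by apply: cvg_norm; apply: cvgB; apply: grid_step_cvg => //;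
  rewrite ?x0 ?(lt_trans xc) //; exact: vw.
Qed.

Lemma kernel_gap_bound (c t0 t r x : R) : 0 < r -> c <= B ->
  c + r < t < B -> c + r < t0 < B -> 0 < x < c ->
  kernel_gap t0 t x <= 2 * M * r `^ (- d) * C * x `^ (- e).
Proof.
move=> r0 cB /andP[tc tB] /andP[t0c t0B] /andP[x0 xc].
have /andP[d0 _] := d01.
have bnd s : c + r < s -> s < B ->
    `|op_between S g (s - x) (w x)| <= M * r `^ (- d) * (C * x `^ (- e)).
  move=> cs sB; apply: le_trans (SM _ _) _; first by apply/andP; split; lra.
  apply: ler_pM => //; first by rewrite mulr_ge0 ?powR_ge0.
    rewrite ler_wpM2l // !powRN lef_pV2 ?posrE ?powR_gt0 //; last lra.
    by apply: ge0_ler_powR; rewrite ?nnegrE //; lra.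
  by apply: wC; rewrite x0 (lt_le_trans xc).
apply: le_trans (ler_normB _ _) _.
apply: le_trans (lerD (bnd _ tc tB) (bnd _ t0c t0B)) _.
by rewrite le_eqVlt; apply/orP; left; apply/eqP; ring.
Qed.

Lemma integrable_kernel_gap_bound (K c : R) : 0 <= K -> 0 < c ->
  mu.-integrable `]0, c[ (fun x => (K * x `^ (- e))%:E).
Proof.
move=> K0 c0; have d001 : 0 <= (0 : R) < 1 by rewrite lexx ltr01.
rewrite (_ : (fun _ => _) = (fun x => ((c - x) `^ (- 0) * (K * x `^ (- e)))%:E)).
  exact: integrable_kernel.
by apply/funext => x; rewrite oppr0 powRr0 mul1r.
Qed.

Lemma integrable_kernel_gap (c t0 t r : R) : 0 < r -> 0 < c -> c <= B ->
  c + r < t < B -> c + r < t0 < B ->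
  mu.-integrable `]0, c[ (EFin \o kernel_gap t0 t).
Proof.
move=> r0 c0 cB tB t0B.
have K0 : 0 <= 2 * M * r `^ (- d) * C by rewrite !mulr_ge0 ?powR_ge0.
apply: le_integrable (integrable_kernel_gap_bound K0 c0) => //.
  apply/measurable_EFinP; apply: measurable_kernel_gap; lra.
move=> x; rewrite /= in_itv /= => xc.
by rewrite lee_fin normr_id (le_trans (kernel_gap_bound r0 cB tB t0B xc)) // ler_norm.
Qed.

(** For [x < c] the times [t - x] and [t0 - x] stay above [r], so that the kernel
    is bounded and dominated convergence applies. *)
Lemma head_integral_cvg (c t0 r : R) : 0 < r -> 0 < c -> c <= B -> c + r < t0 < B ->
  \int[mu]_(x in `]0, c[) kernel_gap t0 t x @[t --> t0] --> 0.
Proof.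
move=> r0 c0 cB t0B.
have K0 : 0 <= 2 * M * r `^ (- d) * C by rewrite !mulr_ge0 ?powR_ge0.
have gap0 : \int[mu]_(x in `]0, c[) kernel_gap t0 t0 x = 0.
  rewrite /Rintegral (_ : (fun _ => _) = cst 0%E) ?integral0 //.
  by apply/funext => x; rewrite /kernel_gap subrr normr0.
rewrite -[X in _ --> X]gap0.
apply: (@continuity_under_integral R _ _ mu (kernel_gap t0) `]0, c[ _ (c + r) B
  _ _ (fun x => 2 * M * r `^ (- d) * C * x `^ (- e)) _ _ t0).
- exact: measurable_itv.
- by move=> t; rewrite /= in_itv /= => tB; exact: (integrable_kernel_gap r0).
- apply: aeW => x; rewrite /= in_itv /= => /andP[x0 xc] t /set_mem.
  rewrite /= in_itv /= => /andP[tc tB].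
  apply: cvg_norm; apply: cvgB; last exact: cvg_cst.
  have tx : 0 < t - x by lra.
  apply: (@continuous_comp _ _ _ (fun s : R => s - x)
    (fun s => op_between S g s (w x) : X g)).
    by apply: cvgB; [exact: cvg_id|exact: cvg_cst].
  exact: smoothing_continuous_at.
- exact: integrable_kernel_gap_bound.
- move=> t; rewrite /= in_itv /= => tB; apply: aeW => x.
  rewrite /= in_itv /= => xc; rewrite ger0_norm; last exact: normr_ge0.
  exact: (kernel_gap_bound r0 cB tB t0B xc).
- by rewrite inE /= in_itv.
Qed.

(** The integrals live on the different intervals [0 < x < t] and [0 < x < t0];
    extended by zero to [0 < x < B] they can be subtracted. *)
Lemma head_integral_norm (c t0 t r : R) A0 A : 0 < r -> 0 < c -> c <= B ->
  c + r < t < B -> c + r < t0 < B ->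
  l1_integral mu `]0, t0[ (fun x => op_between S g (t0 - x) (wcut c x)) A0 ->
  l1_integral mu `]0, t[ (fun x => op_between S g (t - x) (wcut c x)) A ->
  `|A - A0| <= \int[mu]_(x in `]0, c[) kernel_gap t0 t x.
Proof.
move=> r0 c0 cB tB t0B fA0 fA.
have restr s I : c + r < s < B ->
    l1_integral mu `]0, s[ (fun x => op_between S g (s - x) (wcut c x)) I ->
    l1_integral mu `]0, B[
      (fun x => if x < c then op_between S g (s - x) (w x) else 0) I.
  move=> /andP[cs sB] fI.
  have rfI : l1_integral mu `]0, B[
      (fun x => if `[< `]0, s[%classic x >] then op_between S g (s - x) (wcut c x) else 0) I.
    apply: (@l1_integral_restrict _ _ _ _ mu _ _ _ _ _ _ _ fI).
    - exact: measurable_itv.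
    - exact: measurable_itv.
    - by move=> x; rewrite /= !in_itv /= => /andP[-> /=] /lt_trans; exact.
  apply: l1_integral_ext rfI.
  move=> x; rewrite /= in_itv /= => /andP[x0 xB]; rewrite /wcut.
  case: asboolP; rewrite in_itv /= x0 /= => xs; case: ifP => // xc.
    by rewrite (linear_zero (op_between_linear sS _)) // subr_gt0.
  by exfalso; apply: xs; lra.
have gapI := integrable_kernel_gap r0 c0 cB tB t0B.
have fin : (\int[mu]_(x in `]0%R, c[) (kernel_gap t0 t x)%:E)%E \is a fin_num.
  by apply: integrable_fin_num gapI; exact: measurable_itv.
rewrite -lee_fin /Rintegral fineK //.
have -> : (\int[mu]_(x in `]0%R, c[) (kernel_gap t0 t x)%:E =
    \int[mu]_(x in `]0%R, B[) ((EFin \o kernel_gap t0 t) \_ `]0%R, c[) x)%E.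
  rewrite -integral_mkcondr; congr (integral _ _ _).
  apply/seteqP; split => x /=; rewrite !in_itv /=; last by case.
  by move=> /andP[x0 xc]; rewrite x0 xc (lt_le_trans xc).
have mgap : measurable_fun `]0, c[ (kernel_gap t0 t).
  by apply: measurable_kernel_gap; lra.
rewrite addrC -scaleN1r; apply: (@l1_integral_norm _ _ _ _ mu `]0, B[ _ _
  (fun x => -1 *: (if x < c then op_between S g (t0 - x) (w x) else 0) +
    (if x < c then op_between S g (t - x) (w x) else 0))).
- exact: measurable_itv.
- exact: lebesgue_measure_itv_lty.
- apply: l1_integral_linear; [exact: measurable_itv|exact: lebesgue_measure_itv_lty
    |exact: restr|exact: restr].
- apply/(measurable_restrict _ _ _).1; [exact: measurable_itv|exact: measurable_itv|].
  have mgapE : measurable_fun `]0, c[ (EFin \o kernel_gap t0 t).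
    by apply/measurable_EFinP.
  by apply: measurable_funS mgapE; [exact: measurable_itv|move=> x []].
- move=> x; rewrite /= in_itv /= => /andP[x0 xB]; rewrite patchE mem_setE in_itv /= x0 /=.
  case: ifP => xc; last by rewrite scaler0 addr0 normr0.
  by rewrite lee_fin scaleN1r addrC.
Qed.

End Cut.

(** A change of [t] moves the singularity of the kernel, so domination fails on
    the whole interval.  Cut at [c = t0 - s / 2]: the part over [0 < x < c] is
    continuous at [t0] by dominated convergence, and the part over [c <= x < t]
    is [O(s ^ (1 - d))] for all [t < t0 + s / 2]. *)
Lemma duhamel_continuous S b g (e : R) (w : R -> X b) (J : R -> X g) :
  smoothing_continuous S b g -> 0 <= reg_diff g b < 1 -> 0 <= e < 1 ->
  strongly_measurable mu `]0, +oo[ w ->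
  (forall T, 0 < T -> exists2 C, 0 <= C &
     forall x, 0 < x < T -> `|w x| <= C * x `^ (- e)) ->
  (forall t, 0 < t -> l1_integral mu `]0, t[
     (fun x => op_between S g (t - x) (w x)) (J t)) ->
  forall t0 : R, 0 < t0 -> J t @[t --> t0] --> J t0.
Proof.
move=> scS d01 e01 [v [fv [N [mN N0 vN]]]] bw fJ t0 t00.
have vw x : 0 < x -> ~ N x -> v k x @[k --> \oo] --> w x.
  move=> x0; apply: contra_notP => nconv; apply: vN => /=.
  by rewrite in_itv /= x0 => /(_ isT).
(* Setting the functions to zero on the exceptional null set changes none of
   the integrals and makes the convergence hold everywhere. *)
pose v' k x := if `[< N x >] then 0 else v k x.
pose w' x := if `[< N x >] then 0 else w x.
have fv' k : simple_function (v' k).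
  exact: (finitely_valued_comp (fun z : bool * X b => if z.1 then 0 else z.2)
    (finitely_valued_pair (finitely_valued_asbool mN) (fv k))).
have v'w' x : 0 < x -> v' k x @[k --> \oo] --> w' x.
  move=> x0; rewrite /v' /w'; case: asboolP => Nx; first exact: cvg_cst.
  exact: vw.
have fJ' t : 0 < t ->
    l1_integral mu `]0, t[ (fun x => op_between S g (t - x) (w' x)) (J t).
  move=> t_gt0; apply: (l1_integral_ae_ext _ mN N0 _ (fJ t t_gt0)).
    exact: measurable_itv.
  by move=> x _ Nx; rewrite /w' asboolF.
(* The bounds are taken on one interval that contains all [t] near [t0]. *)
pose B := 2 * t0.
have B0 : 0 < B by rewrite mulr_gt0.
have t0B : t0 < B by rewrite /B; lra.
have [C C0 wC] := bw B B0.
have w'C x : 0 < x < B -> `|w' x| <= C * x `^ (- e).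
  move=> xB; rewrite /w'; case: ifP => _; last exact: wC.
  by rewrite normr0 mulr_ge0 ?powR_ge0.
have [sS _] := scS; have [M M0 SM] := smoothing_bound sS B0.
have /andP[d0 d1] := d01; have /andP[e0 e1] := e01.
set d := reg_diff g b in d01 d0 d1 SM.
apply/cvgrPdist_lt => eps eps0.
pose H := C * (t0 / 2) `^ (- e).
have H0 : 0 <= H by rewrite mulr_ge0 ?powR_ge0.
have eps2 : 0 < eps / 2 by lra.
have [s /andP[s0 st0] smalls] :=
  exists_powR_small (2 * M * H / (1 - d)) d1 t00 eps2.
pose c := t0 - s / 2.
have c0 : 0 < c by rewrite /c; lra.
have ct0B : c < t0 < B by rewrite /c; apply/andP; split; lra.
have r0 : 0 < s / 4 by lra.
have cB : c <= B by rewrite /c; lra.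
have rt0 : c + s / 4 < t0 < B by rewrite /c; apply/andP; split; lra.
have tail t A : c < t < B -> t < t0 + s / 2 ->
    l1_integral mu `]0, t[ (fun x => op_between S g (t - x) (if x < c then w' x else 0)) A ->
    `|J t - A| <= M * H / (1 - d) * s `^ (1 - d).
  move=> tB ts fA.
  apply: le_trans (tail_integral_norm scS d01 e01 C0 M0 w'C SM fJ' c0 tB fA) _.
  have /andP[ct _] := tB.
  rewrite [leRHS](_ : _ = M * H * (s `^ (1 - d) / (1 - d))); last by ring.
  have d1' : 0 < 1 - d by rewrite subr_gt0.
  apply: ler_pM; rewrite ?mulr_ge0 ?powR_ge0 ?invr_ge0 ?(ltW d1') //.
    rewrite ler_wpM2l // ler_wpM2l // !powRN lef_pV2 ?posrE ?powR_gt0 //; last lra.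
    by apply: ge0_ler_powR; rewrite ?nnegrE // /c; lra.
  rewrite ler_pM2r ?invr_gt0 //.
  have tc0 : 0 <= t - c by lra.
  have tcs : t - c <= s by move: ts; rewrite /c; lra.
  by apply: ge0_ler_powR; rewrite ?nnegrE //; exact: ltW.
have [A0 fA0] := head_integral_exists scS d01 e01 fv' v'w' C0 w'C c0 ct0B.
have phi0 := head_integral_cvg scS d01 e01 fv' v'w' C0 M0 w'C SM r0 c0 cB rt0.
near=> t.
have tlo : c + s / 4 < t.
  by near: t; apply: lt_nbhsr; case/andP: rt0.
have thi : t < t0 + s / 2 by near: t; apply: lt_nbhsl; lra.
have tB : t < B by near: t; exact: lt_nbhsl.
have ctB : c < t < B by apply/andP; split; lra.
have rtB : c + s / 4 < t < B by apply/andP; split.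
have [A fA] := head_integral_exists scS d01 e01 fv' v'w' C0 w'C c0 ctB.
have jump := head_integral_norm scS d01 e01 fv' v'w' C0 M0 w'C SM r0 c0 cB rtB rt0 fA0 fA.
have jumplt : `|A - A0| < eps / 2.
  apply: le_lt_trans jump _; near: t.
  exact: (cvgr_lt _ phi0 _ eps2).
have tail0 := tail t0 A0 ct0B (ltac:(lra)) fA0.
have tailt := tail t A ctB thi fA.
have -> : J t0 - J t = (J t0 - A0) - (A - A0) - (J t - A).
  by rewrite !opprB !subrKA.
have tri : `|J t0 - A0 - (A - A0) - (J t - A)| <=
    `|J t0 - A0| + `|A - A0| + `|J t - A|.
  apply: le_trans (ler_normB _ _) _; rewrite lerD2r; exact: ler_normB.
apply: le_lt_trans tri _.
have : 2 * M * H / (1 - d) * s `^ (1 - d) =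
  M * H / (1 - d) * s `^ (1 - d) + M * H / (1 - d) * s `^ (1 - d) by ring.
lra.
Unshelve. all: by end_near. Qed.

End DuhamelContinuity.

(** * The perturbed family *)

Section PerturbedFamily.
Context (R : realType) (X : banach_scale R).
Local Notation mu := (@lebesgue_measure R).
Variables (S : op_family X) (alpha : scale_index X) (n : nat).
Variables (beta : 'I_n -> scale_index X) (rho : R).
Variable P : forall i : 'I_n, X alpha -> X (beta i).
Hypothesis rho_ge0 : 0 <= rho.
Hypothesis hP : forall i : 'I_n, perturbation_class S rho (P i).
Variable SP : op_family X.
Hypothesis hSP : is_perturbed_family S P SP.

Lemma strongly_measurable_perturbation i D (u : R -> X alpha) :
  strongly_measurable mu D u -> strongly_measurable mu D (fun x => P i (u x)).
Proof.
have [_ _ [_ cP] _] := hP i.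
move=> [s [fs sv]]; exists (fun k x => P i (s k x)); split.
  by move=> k; exact: (finitely_valued_comp (P i) (fs k)).
by apply: filterS sv => x sux Dx; exact: (cvg_comp _ _ (sux Dx) (cP (u x))).
Qed.

Section Target.
Variables gamma gamma' : scale_index X.
Hypothesis hgamma : scrE S alpha gamma.
Hypothesis hgamma' : (\bigcap_(i in [set: 'I_n]) scrR S (beta i)) gamma'.
Hypothesis sgg' : smoothing S gamma gamma'.
Local Notation e := (reg_diff alpha gamma).

Lemma perturbed_mild_solution (u0 : X gamma) : exists u,
  [/\ strongly_measurable mu `]0, +oo[ u, mild_solution S P u0 u
    & forall t, 0 < t -> SP t u0 = incl alpha (u t)].
Proof.
have [_ [u [uL us SPu]]] := hSP u0 hgamma; exists u; split => //.
  by case: uL.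
exact: Linfty_mild_solution.
Qed.

Lemma target_smoothing i : smoothing_continuous S (beta i) gamma'.
Proof. by have [] : scrR S (beta i) gamma' by exact: hgamma'. Qed.

Lemma target_exponent i : 0 <= reg_diff gamma' (beta i) < 1.
Proof.
have [+ _] : scrR S (beta i) gamma' by exact: hgamma'.
rewrite /= in_itv /= /reg_diff => /andP[? ?].
by apply/andP; split; lra.
Qed.

Lemma perturbation_exponent i : 0 <= reg_diff alpha (beta i) < 1.
Proof. by have [] := hP i. Qed.

Lemma perturbation_smoothing i : smoothing_continuous S (beta i) alpha.
Proof. by have [] := hP i. Qed.

Lemma mild_perturbation_bound T : 0 < T -> exists2 C, 0 <= C &
  forall (u0 : X gamma) u, mild_solution S P u0 u -> forall i x, 0 < x <= T ->
    `|P i (u x)| <= rho * C * `|u0| * x `^ (- e).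
Proof.
move=> T0; have [C C0 Cb] := mild_solution_bound rho_ge0 hP hgamma T0.
exists C => // u0 u su i x xT; apply: le_trans (perturbation_norm hP i _) _.
by rewrite -!mulrA ler_wpM2l // mulrA; exact: Cb.
Qed.

(** The kernels of [S] from [X beta_i] to [X gamma'] are integrable, so every
    integral in the formula has a counterpart in [X gamma'], identified with it
    by the consistency of the scale. *)
Lemma mild_solution_in_target (u0 : X gamma) u :
  strongly_measurable mu `]0, +oo[ u -> mild_solution S P u0 u ->
  exists J : 'I_n -> R -> X gamma',
    (forall i t, 0 < t -> l1_integral mu `]0, t[
       (fun x => op_between S gamma' (t - x) (P i (u x))) (J i t)) /\
    forall t, 0 < t -> incl alpha (u t) =
      incl gamma' (op_between S gamma' t u0 + \sum_(i < n) J i t).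
Proof.
move=> mu_u su; have e01 := scrE_exponent hgamma.
pose J i t := xget 0 [set I' | l1_integral mu `]0, t[
  (fun x => op_between S gamma' (t - x) (P i (u x))) I'].
have fJ i t I' : l1_integral mu `]0, t[
    (fun x => op_between S gamma' (t - x) (P i (u x))) I' ->
    l1_integral mu `]0, t[
      (fun x => op_between S gamma' (t - x) (P i (u x))) (J i t).
  by move=> fI'; apply: (xgetPex 0); exists I'.
have both i t : 0 < t -> exists I I',
  [/\ l1_integral mu `]0, t[ (fun x => op_between S alpha (t - x) (P i (u x))) I,
      l1_integral mu `]0, t[ (fun x => op_between S gamma' (t - x) (P i (u x))) I'
    & incl alpha I = incl gamma' I'].
  move=> t0; have [C C0 Cb] := mild_perturbation_bound t0.
  have K0 : 0 <= rho * C * `|u0| by rewrite !mulr_ge0.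
  apply: (duhamel_consistent (h := fun x => rho * C * `|u0| * x `^ (- e))
    (perturbation_smoothing i) (target_smoothing i) t0).
  - exact: strongly_measurable_perturbation.
  - by apply: measurable_funM => //; exact: measurable_powR.
  - by move=> x /andP[x0 xt]; apply: (Cb _ _ su); rewrite x0 ltW.
  - by apply: integrable_kernel => //; exact: perturbation_exponent.
  - by apply: integrable_kernel => //; exact: target_exponent.
exists J; split.
  by move=> i t t0; have [_ [I' [_ fI' _]]] := both i t t0; exact: (fJ _ _ I').
move=> t t0; have [_ /(_ t t0)[I [fI ->]]] := su.
rewrite !linearD !linear_sum /=; congr (_ + _).
  have [_ [sga _]] := hgamma.
  by rewrite (incl_op_between _ sga t0) (incl_op_between _ sgg' t0).
apply: eq_bigr => i _; have [I1 [I1' [fI1 fI1' II']]] := both i t t0.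
have -> : I i = I1.
  apply: (l1_integral_unique _ _ (fI i) fI1); first exact: measurable_itv.
  exact: lebesgue_measure_itv_lty.
have -> : J i t = I1'.
  apply: (l1_integral_unique _ _ (fJ _ _ _ fI1') fI1'); first exact: measurable_itv.
  exact: lebesgue_measure_itv_lty.
exact: II'.
Qed.

Lemma op_between_perturbed (u0 : X gamma) u (J : 'I_n -> R -> X gamma') :
  (forall t, 0 < t -> SP t u0 = incl alpha (u t)) ->
  (forall t, 0 < t -> incl alpha (u t) =
      incl gamma' (op_between S gamma' t u0 + \sum_(i < n) J i t)) ->
  forall t, 0 < t -> op_between SP gamma' t u0 =
    op_between S gamma' t u0 + \sum_(i < n) J i t.
Proof. by move=> SPu uJ t t0; rewrite /op_between SPu // uJ // val_in_incl. Qed.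

Lemma range_perturbed t (u0 : X gamma) : 0 < t -> range (incl gamma') (SP t u0).
Proof.
move=> t0; have [u [mu_u su SPu]] := perturbed_mild_solution u0.
have [J [_ uJ]] := mild_solution_in_target mu_u su.
by rewrite SPu // uJ //; eexists.
Qed.

(** Linearity comes from uniqueness: a linear combination of solutions solves
    the equation with the combined datum. *)
Lemma perturbed_linear t : 0 < t ->
  linear (op_between SP gamma' t : X gamma -> X gamma').
Proof.
move=> t0 a u0 v0; apply: (@incl_inj _ X gamma').
rewrite linearD linearZ /= !incl_val_in; try exact: range_perturbed.
have [u [_ su SPu]] := perturbed_mild_solution u0.
have [v [_ sv SPv]] := perturbed_mild_solution v0.
have [z [_ sz SPz]] := perturbed_mild_solution (a *: u0 + v0).
rewrite SPu // SPv // SPz //.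
rewrite (mild_solution_unique rho_ge0 hP hgamma sz (mild_solution_linear hP hgamma a su sv) t0).
by rewrite linearD linearZ.
Qed.

(** The powers of [t] add up: the exponent [1 - d(gamma', beta_i) - d(alpha, gamma)]
    of the [i]-th integral equals [1 - d(alpha, beta_i) - d(gamma', gamma)], and
    [1 - d(alpha, beta_i)] is positive. *)
Lemma perturbed_smoothing : smoothing SP gamma gamma'.
Proof.
apply: smoothing_of_bound; first by case: sgg'.
- by move=> t t0 u0; exact: range_perturbed.
- exact: perturbed_linear.
move=> T T0; have [C C0 Cb] := mild_perturbation_bound T0.
have [M0 M00 SM0] := smoothing_bound sgg' T0.
have /fin_all_exists2[M Mge0 SM] : forall i : 'I_n, exists2 M : R, 0 <= M &
    forall t (u : X (beta i)), 0 < t <= T ->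
    `|op_between S gamma' t u| <= M * t `^ (- reg_diff gamma' (beta i)) * `|u|.
  by move=> i; have [sSi _] := target_smoothing i; exact: smoothing_bound.
pose d i := reg_diff gamma' (beta i).
pose c i := M i * (rho * C) * beta_bound (d i) e * T `^ (1 - reg_diff alpha (beta i)).
have e01 := scrE_exponent hgamma; have /andP[e0 e1] := e01.
have c0 i : 0 <= c i.
  have /andP[_ d1] := target_exponent i.
  by rewrite !mulr_ge0 ?powR_ge0 // beta_bound_ge0.
exists (M0 + \sum_(i < n) c i); first by rewrite addr_ge0 // sumr_ge0.
move=> t u0 tT; have /andP[t0 tT'] := tT.
have [u [mu_u su SPu]] := perturbed_mild_solution u0.
have [J [fJ uJ]] := mild_solution_in_target mu_u su.
rewrite (op_between_perturbed SPu uJ t0).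
have bJ i : `|J i t| <= c i * t `^ (- reg_diff gamma' gamma) * `|u0|.
  have SMt s (x : X (beta i)) : 0 < s <= t ->
      `|op_between S gamma' s x| <= M i * s `^ (- d i) * `|x|.
    by move=> /andP[s0 st]; apply: SM; rewrite s0 (le_trans st).
  have Pu x : 0 < x < t -> `|P i (u x)| <= rho * C * `|u0| * x `^ (- e).
    by move=> /andP[x0 xt]; apply: (Cb _ _ su); rewrite x0 (le_trans (ltW xt)).
  have K0 : 0 <= rho * C * `|u0| by rewrite !mulr_ge0.
  apply: le_trans (duhamel_norm_pow t0 (target_exponent i) e01 (Mge0 i) K0 SMt
    (fJ i t t0) Pu) _.
  have -> : t `^ (1 - reg_diff gamma' (beta i) - e) =
      t `^ (1 - reg_diff alpha (beta i)) * t `^ (- reg_diff gamma' gamma).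
    rewrite -powRD; last by apply/implyP => _; rewrite gt_eqF.
    by congr (_ `^ _); rewrite /reg_diff; ring.
  rewrite [leLHS](_ : _ = M i * (rho * C) * beta_bound (d i) e *
    t `^ (1 - reg_diff alpha (beta i)) * (t `^ (- reg_diff gamma' gamma) * `|u0|));
    last by rewrite /d; ring.
  rewrite -[leRHS]mulrA ler_wpM2r ?mulr_ge0 ?powR_ge0 //.
  have /andP[_ d1] := target_exponent i.
  rewrite /c ler_wpM2l //; first by rewrite !mulr_ge0 // beta_bound_ge0.
  have /andP[_ a1] := perturbation_exponent i.
  by apply: ge0_ler_powR; rewrite ?nnegrE ?subr_ge0 //; exact: ltW.
apply: le_trans (ler_normD _ _) _; rewrite !mulrDl lerD //; first exact: SM0.
apply: le_trans (ler_norm_sum _ _ _) _; apply: le_trans (ler_sum _ (fun i _ => bJ i)) _.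
by rewrite !mulr_suml.
Qed.

Lemma perturbed_continuous : smoothing_continuous S gamma gamma' ->
  smoothing_continuous SP gamma gamma'.
Proof.
move=> scgg'; split; first exact: perturbed_smoothing.
move=> u0; rewrite continuous_open_subspace; last exact: interval_open.
move=> t /set_mem; rewrite /= in_itv /= andbT => t0.
have [u [mu_u su SPu]] := perturbed_mild_solution u0.
have [J [fJ uJ]] := mild_solution_in_target mu_u su.
have SPE := op_between_perturbed SPu uJ.
have cSP : op_between S gamma' s u0 + \sum_(i < n) J i s @[s --> t] -->
    op_between S gamma' t u0 + \sum_(i < n) J i t.
  apply: cvgD; first exact: (smoothing_continuous_at (u := u0) scgg' t0).
  apply: cvg_big => [|i _]; first exact: add_continuous.
  apply: (duhamel_continuous (e := e) (w := fun x => P i (u x))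
    (target_smoothing i) (target_exponent i) (scrE_exponent hgamma)) => //.
  - exact: strongly_measurable_perturbation.
  - move=> T T0; have [C C0 Cb] := mild_perturbation_bound T0.
    exists (rho * C * `|u0|); first by rewrite !mulr_ge0.
    by move=> x /andP[x0 xT]; apply: (Cb _ _ su); rewrite x0 ltW.
  - by move=> s s0; exact: fJ.
rewrite -SPE // in cSP; apply: cvg_trans cSP; apply: near_eq_cvg.
by near=> s; rewrite SPE //; near: s; exact: lt_nbhsr.
Unshelve. all: by end_near. Qed.

End Target.
End PerturbedFamily.

Theorem theorem6p9 (R : realType) (X : banach_scale R) (S : op_family X)
    (hS : consistent_family S)
    (alpha : scale_index X) (n : nat) (beta : 'I_n -> scale_index X)
    (rho : R) (hrho : 0 < rho)
    (P : forall i : 'I_n, X alpha -> X (beta i))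
    (hP : forall i : 'I_n, perturbation_class S rho (P i))
    (SP : op_family X) (hSP : is_perturbed_family S P SP) :
  (\bigcap_(i in [set: 'I_n]) scrR S (beta i)) alpha /\
  (forall gamma gamma' : scale_index X,
     scrE S alpha gamma ->
     (\bigcap_(i in [set: 'I_n]) scrR S (beta i)) gamma' ->
     smoothing S gamma gamma' -> smoothing SP gamma gamma') /\
  (forall gamma gamma' : scale_index X,
     scrE S alpha gamma ->
     (\bigcap_(i in [set: 'I_n]) scrR S (beta i)) gamma' ->
     smoothing_continuous S gamma gamma' ->
     smoothing_continuous SP gamma gamma').
Proof.
split; last split.
- move=> i _; have [+ sc _ _] := hP i; rewrite /reg_diff => /andP[d0 d1].
  by split => //; rewrite in_itv /=; apply/andP; split; lra.
- by move=> gamma gamma' hg hg' sgg'; exact: (perturbed_smoothing (ltW hrho) hP hSP).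
- move=> gamma gamma' hg hg' scgg'; have [sgg' _] := scgg'.
  exact: (perturbed_continuous (ltW hrho) hP hSP).
Qed.
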